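(* Let $\mathcal{A}^w_1,\dots,\mathcal{A}^w_n$ be finite weighted labelled transition systems, $\mathbf{A}^w=\mathcal{A}^w_1\parallel_w\cdots\parallel_w\mathcal{A}^w_n$, with interface $\mathcal{A}^w_i$. Every run of Algorithm 2 (applied to the underlying unweighted composition, for every choice of the order of added events) terminates and returns a weighted branching process $\mathcal{N}^w$ such that the folding $\mathcal{S}^w_i$ of the weighted interface projection $\mathcal{N}^w_i$ satisfies $\mathrm{Tr}(\mathcal{S}^w_i)=\mathrm{Tr}(\mathbf{A}^w)|_{\Sigma_i}$, i.e. $\mathcal{S}^w_i$ is a weighted summary of $\mathbf{A}^w$.
   Context: A labelled transition system (LTS) is $\mathcal{A}=(\Sigma,S,T,\lambda,s^0)$ with finite actions, finite states, $T\subseteq S\times S$, $\lambda:T\to\Sigma$, initial state $s^0$; histories are sequences of transitions $t_k=(s_{k-1},s_k)$ with $s_0=s^0$; traces are their label sequences. A weighted LTS $\mathcal{A}^w=(\mathcal{A},c)$ adds $c:T\to\mathbb{R}_{\ge0}$. A weighted trace is $(\sigma,w)$ with $\sigma$ a finite trace and $w$ the minimal total weight of a history labelled $\sigma$; $\mathrm{Tr}(\mathcal{A}^w)$ is the set of weighted traces. (Folded LTSs below may have several labelled, weighted transitions between the same states; weighted traces are defined the same way.) For $\mathcal{A}_j=(\Sigma_j,S_j,T_j,\lambda_j,s^0_j)$, $\mathbf{A}=\mathcal{A}_1\parallel\cdots\parallel\mathcal{A}_n$ has global states in $S_1\times\cdots\times S_n$, initial $(s^0_1,\dots,s^0_n)$,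 and global transitions $\mathbf{t}=(t_1,\dots,t_n)\neq(\star,\dots,\star)$ labelled $a$, with $t_j$ an $a$-transition of $\mathcal{A}_j$ if $a\in\Sigma_j$ and $t_j=\star$ otherwise ($\mathcal{A}_j$ participates iff $t_j\ne\star$); ${}^\bullet\mathbf{t}$/$\mathbf{t}^\bullet$ are source/target states of the $t_j\neq\star$. The weighted composition $\mathbf{A}^w=(\mathbf{A},\mathbf{c})$ has $\mathbf{c}(\mathbf{t})=\sum_{t_j\ne\star}c_j(t_j)$. For a set $W$ of weighted traces, $W|_{\Sigma_i}=\{(\sigma,w): \exists(\sigma',w')\in W,\ \sigma=\sigma'|_{\Sigma_i},\ w=\min\{w':(\sigma',w')\in W,\ \sigma'|_{\Sigma_i}=\sigma\}\}$ ($|_{\Sigma_i}$ = projection onto $\Sigma_i$). The weighted summary problem asks for a weighted LTS $\mathcal{S}^w_i$ with $\mathrm{Tr}(\mathcal{S}^w_i)=\mathrm{Tr}(\mathbf{A}^w)|_{\Sigma_i}$. Branching processes of $\mathbf{A}$: Petri nets with conditions labelled by local states and events labelled by global transitions, defined inductively: the net with conditions $b^0_1,\dots,b^0_n$ labelled $s^0_1,\dots,s^0_n$ and no events is one; if a reachable marking contains a set $M$ of conditions labelled exactly by ${}^\bullet\mathbf{t}$ and no event labelled $\mathbf{t}$ has input set $M$, adding an event labelled $\mathbf{t}$ with inputs $M$ and fresh outputs labelled by the states of $\mathbf{t}^\bullet$ gives a branching process (a possible extension). In the weighted branching process each event $e$ labelled $\mathbf{t}$ has weight $c(e)=\mathbf{c}(\mathbf{t})$.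 $x<y$: nonempty arc path from $x$ to $y$; conflict: some condition $z\ne x,y$ from which both are reached leaving $z$ by different arcs; concurrent: neither causally related nor in conflict. $[e]=\{e':e'\le e\}$, $c([e])=\sum_{e''\in[e]}c(e'')$; $M(e)$: marking reached by firing exactly $[e]$; $M(e)_j$: its condition labelled by a state of $\mathcal{A}_j$; $\mathrm{St}(e)$: global state of labels of $M(e)$. $i$-events: events where $\mathcal{A}_i$ participates; $ip(e)=M(e)_i$. $e'\ll e$ iff $e'<e$ and $b'<b$ for all $b\in M(e)\setminus M(e')$, $b'\in M(e')\setminus M(e)$. For the current $\mathcal{N}$ and a new event $e$: $\mathrm{Con}_i(\mathcal{N},e)$ = non-cut-off $i$-events of $\mathcal{N}$ concurrent with $e$; $e$ is a cut-off if it is an $i$-event and $\mathcal{N}$ contains an $i$-event $e'$ (companion) with $\mathrm{St}(e)=\mathrm{St}(e')$; $e$ is a cut-off candidate of $\mathcal{N}$ if it is not an $i$-event and $\mathcal{N}$ contains $e'\ll e$ with $\mathrm{St}(e)=\mathrm{St}(e')$, $ip(e')=ip(e)$, $\mathrm{Con}_i(\mathcal{N},e)\subseteq\mathrm{Con}_i(\mathcal{N},e')$; $e$ frees a candidate $e_c$ if $e_c$ is no longer a cut-off candidate after adding $e$. Algorithm 2: start with the event-free process, $co=coc=\emptyset$; while some possible extension has no event of $co\cup coc$ in its causal past, choose any such $e$: if a cut-off, add to $co$; else if a cut-off candidate, add to $coc$; else remove from $coc$ every event $e$ frees; then add $e$ to $\mathcal{N}$. At the end $\equiv$ is the smallest equivalence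 on $\mathcal{A}_i$-labelled conditions with $M(e)_i\equiv M(e')_i$ for each $e\in co$ with companion $e'$. Weighted interface projection $\mathcal{N}^w_i$: the LTS whose states are $\mathcal{A}_i$-labelled conditions, initial state $b^0_i$, with a transition $(b,b')$ for each $i$-event $e$ with input $i$-condition $b$, output $i$-condition $b'$, labelled by the action of $e$ and with weight $c_i(e)=c([e])-c([e'])$ if $b$ is the output of an event $e'$ (the predecessor of $e$ in $\mathcal{N}^w_i$), and $c_i(e)=c([e])$ if $b=b^0_i$. Its folding $\mathcal{S}^w_i$ has states $[b]_\equiv$, initial $[b^0_i]_\equiv$, and a transition $([b]_\equiv,[b']_\equiv)$ with the same label and weight for each transition $(b,b')$ of $\mathcal{N}^w_i$. *)

(* Defs.v *)
From HB Require Import structures.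
From mathcomp Require Import all_boot all_order all_algebra.
From mathcomp Require Import boolp reals.
From Stdlib Require Import Relations.
Set Implicit Arguments.
Unset Strict Implicit.
Unset Printing Implicit Defensive.
Import Order.TTheory GRing.Theory Num.Theory.

Section Generic.
Variables (Sig : finType) (R : realType).

Fixpoint run {Q T : Type} (step : Q -> T -> Q -> Prop) (q : Q) (h : seq T) : Prop :=
  if h is t :: h' then exists q', step q t q' /\ run step q' h' else True.

Definition wtrace {Q T : Type} (step : Q -> T -> Q -> Prop) (q0 : Q)
    (lab : T -> Sig) (wt : T -> R) (sigma : seq Sig) (w : R) : Prop :=
  (exists h, run step q0 h /\ map lab h = sigma /\ (\sum_(t <- h) wt t)%R = w) /\
  (forall h, run step q0 h -> map lab h = sigma -> (w <= \sum_(t <- h) wt t)%R).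

Definition wproj (W : seq Sig -> R -> Prop) (Si : {set Sig}) (sigma : seq Sig) (w : R) : Prop :=
  (exists sigma', W sigma' w /\ [seq a <- sigma' | a \in Si] = sigma) /\
  (forall sigma' w', W sigma' w' -> [seq a <- sigma' | a \in Si] = sigma -> (w <= w')%R).
End Generic.

Record wlts (Sig : finType) (R : realType) := WLts {
  cst : finType;
  cinit : cst;
  calph : {set Sig};
  ctr : {set cst * cst};
  clab : cst * cst -> Sig;
  cw : cst * cst -> R }.
Arguments cst {Sig R} w.
Arguments cinit {Sig R} w.
Arguments calph {Sig R} w.
Arguments ctr {Sig R} w.
Arguments clab {Sig R} w _.
Arguments cw {Sig R} w _.

Definition wlts_wf (Sig : finType) (R : realType) (L : wlts Sig R) : Prop :=
  (forall p, p \in ctr L -> clab L p \in calph L) /\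
  (forall p, p \in ctr L -> (0 <= cw L p)%R).

Section Composition.
Variables (Sig : finType) (R : realType) (n : nat) (A : 'I_n -> wlts Sig R).

Definition lstate (j : 'I_n) : finType := cst (A j).

(* global transitions: an action and, for each component, either a local
   transition (Some p) or * (None) *)
Definition gtrans := (Sig * {dffun forall j : 'I_n, option (lstate j * lstate j)})%type.
Definition gstate := {dffun forall j : 'I_n, lstate j}.

Definition gvalid (t : gtrans) : Prop :=
  (exists j, t.2 j != None) /\
  (forall j, if t.1 \in calph (A j)
             then exists p, t.2 j = Some p /\ p \in ctr (A j) /\ clab (A j) p = t.1
             else t.2 j = None).

Definition gweight (t : gtrans) : R :=
  (\sum_(j < n) (if t.2 j is Some p then cw (A j) p else 0))%R.

Definition ginit : gstate := [ffun j => cinit (A j)].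

Definition gstep (s : gstate) (t : gtrans) (s' : gstate) : Prop :=
  gvalid t /\
  forall j, match t.2 j with
            | Some p => s j = p.1 /\ s' j = p.2
            | None => s' j = s j
            end.

Definition global_wtrace : seq Sig -> R -> Prop :=
  wtrace gstep ginit (fun t : gtrans => t.1) gweight.

(* Branching processes, represented concretely: a net is the sequence *)
(* of its events in order of addition; event k is a pair (label,      *)
(* preset). Conditions are (None, j) = b^0_j and (Some k, j) = the    *)
(* output condition of event k in component j.                        *)
Definition cond := (option nat * 'I_n)%type.
Definition event := (gtrans * seq cond)%type.
Definition net := seq event.
Definition node := (cond + nat)%type.   (* inl = condition, inr = event *)

Variable N : net.

Definition evlab (k : nat) : option gtrans := omap fst (onth N k).
Definition evpre (k : nat) : seq cond := if onth N k is Some e then e.2 else [::].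
Definition partb (k : nat) (j : 'I_n) : bool :=
  if evlab k is Some t then t.2 j != None else false.

Definition isCond (b : cond) : Prop :=
  if b.1 is Some k then partb k b.2 else True.

Definition condlab (b : cond) : option {j : 'I_n & lstate j} :=
  match b with
  | (None, j) => Some (Tagged lstate (cinit (A j)))
  | (Some k, j) =>
      if evlab k is Some t then
        if t.2 j is Some p then Some (Tagged lstate p.2) else None
      else None
  end.

Definition post (k : nat) : seq cond := [seq (Some k, j) | j <- enum 'I_n & partb k j].

Definition arc (x y : node) : Prop :=
  match x, y with
  | inl b, inr k => k < size N /\ b \in evpre k
  | inr k, inl b => b.1 = Some k /\ partb k b.2
  | _, _ => False
  end.

Definition nlt : node -> node -> Prop := clos_trans node arc.
Definition nle (x y : node) : Prop := x = y \/ nlt x y.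

Definition confl (x y : node) : Prop :=
  exists (z : cond) (e1 e2 : nat), e1 <> e2 /\ arc (inl z) (inr e1) /\
    arc (inl z) (inr e2) /\ nle (inr e1) x /\ nle (inr e2) y.

Definition concurrent (x y : node) : Prop :=
  ~ nle x y /\ ~ nle y x /\ ~ confl x y.

Definition inconf (e k : nat) : Prop := k < size N /\ nle (inr k) (inr e).
Definition ewt (k : nat) : R := if evlab k is Some t then gweight t else 0%R.
Definition cconf (e : nat) : R := (\sum_(k <- iota 0 (size N) | `[< inconf e k >]) ewt k)%R.

(* M(e): the marking reached by firing exactly [e] *)
Definition inM (e : nat) (b : cond) : Prop :=
  isCond b /\
  (if b.1 is Some k then inconf e k else True) /\
  ~ (exists k, inconf e k /\ b \in evpre k).

(* St(e) = St(e') (equality of the global states labelling M(e), M(e')) *)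
Definition sameSt (e e' : nat) : Prop :=
  forall x, (exists b, inM e b /\ condlab b = Some x) <->
            (exists b, inM e' b /\ condlab b = Some x).

Definition minit : seq cond := [seq (None, j) | j <- enum 'I_n].
Inductive reachable : seq cond -> Prop :=
| reach0 : reachable minit
| reachS m k : reachable m -> k < size N -> all (mem m) (evpre k) ->
    reachable ([seq b <- m | b \notin evpre k] ++ post k).

Definition pre_t (t : gtrans) : seq {j : 'I_n & lstate j} :=
  pmap (fun j => omap (fun p : lstate j * lstate j => Tagged lstate p.1) (t.2 j)) (enum 'I_n).

Definition pext (t : gtrans) (M : seq cond) : Prop :=
  gvalid t /\
  (exists m, reachable m /\ {subset M <= m}) /\
  perm_eq (map condlab M) (map Some (pre_t t)) /\
  ~ (exists k, k < size N /\ evlab k = Some t /\ evpre k =i M).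

Variable i : 'I_n.

Definition iev (k : nat) : bool := partb k i.

Definition sameip (e e' : nat) : Prop :=
  forall b, b.2 = i -> (inM e b <-> inM e' b).

Definition llt (e' e : nat) : Prop :=
  nlt (inr e') (inr e) /\
  forall b b', inM e b -> ~ inM e' b -> inM e' b' -> ~ inM e b' -> nlt (inl b') (inl b).

Variable co : seq (nat * nat).   (* cut-off events with their companions *)

Definition Con (e k : nat) : Prop :=
  k < size N /\ iev k /\ k \notin map fst co /\ concurrent (inr k) (inr e).

Definition cutoff (e : nat) : Prop :=
  iev e /\ exists c, c < e /\ iev c /\ sameSt e c.

Definition cand (e : nat) : Prop :=
  ~~ iev e /\ exists e', llt e' e /\ sameSt e e' /\ sameip e e' /\
                         (forall k, Con e k -> Con e' k).

End Composition.

Section Algorithm.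
Variables (Sig : finType) (R : realType) (n : nat) (A : 'I_n -> wlts Sig R) (i : 'I_n).

Definition astate := (net A * seq (nat * nat) * seq nat)%type.
Definition ainit : astate := ([::], [::], [::]).

Definition past_free (N : net A) (co : seq (nat * nat)) (coc : seq nat) (t : gtrans A) (M : seq (cond n)) :=
  forall k, k \in map fst co ++ coc -> ~ nlt (rcons N (t, M)) (inr k) (inr (size N)).

Definition alg_step (s s' : astate) : Prop :=
  let: (N, co, coc) := s in
  let: (N', co', coc') := s' in
  exists t M, pext N t M /\ past_free N co coc t M /\ N' = rcons N (t, M) /\
  let e := size N in
  [\/ exists c, c < e /\ iev N' i e /\ iev N' i c /\ sameSt N' e c /\
               co' = rcons co (e, c) /\ coc' = coc,
      ~ cutoff N' i e /\ cand N' i co e /\ co' = co /\ coc' = rcons coc e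
    | ~ cutoff N' i e /\ ~ cand N' i co e /\ co' = co /\
      coc' = [seq x <- coc | `[< cand N' i co x >]] ].

Definition alg_final (s : astate) : Prop :=
  let: (N, co, coc) := s in
  ~ exists t M, pext N t M /\ past_free N co coc t M.

Definition cequiv (N : net A) (co : seq (nat * nat)) : cond n -> cond n -> Prop :=
  clos_refl_sym_trans (cond n)
    (fun b b' => exists e e', (e, e') \in co /\ b.2 = i /\ b'.2 = i /\ inM N e b /\ inM N e' b').

Definition ciw (N : net A) (k : nat) : R :=
  match ohead [seq b <- evpre N k | b.2 == i] with
  | Some (Some k', _) => (cconf N k - cconf N k')%R
  | _ => cconf N k
  end.

(* the folding S^w_i of N^w_i: states are ≡-classes of A_i-conditions
   (represented by a member), one transition ([b],[b']) per transition (b,b')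
   of N^w_i, i.e. per i-event k with input i-condition b and output (k,i);
   transitions are identified with (k, label of k). *)
Definition fstep (N : net A) (co : seq (nat * nat)) (q : cond n) (kt : nat * gtrans A) (q' : cond n) : Prop :=
  let: (k, t) := kt in
  k < size N /\ iev N i k /\ evlab N k = Some t /\
  (exists b, b \in evpre N k /\ b.2 = i /\ cequiv N co q b) /\
  cequiv N co q' (Some k, i).

Definition fold_wtrace (N : net A) (co : seq (nat * nat)) : seq Sig -> R -> Prop :=
  wtrace (fstep N co) (None, i) (fun kt : nat * gtrans A => kt.2.1) (fun kt => ciw N kt.1).

End Algorithm.

(* Main.v *)
Require Import Defs.
From HB Require Import structures.
From mathcomp Require Import all_boot all_order all_algebra.
From mathcomp Require Import boolp reals zify lra.
From Stdlib Require Import Relations.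

(* A configuration is a downward closed, conflict-free set of events; firing it
   in order of addition is a run of the composition, and its marking has one
   condition per component.

   Soundness.  The edge of the folding given by an i-event [k] with predecessor [k']
   is realised by firing [[k]] \ [[k']], whose weight is the weight of the edge and
   whose only i-event is [k]; identified conditions have the same global state.

   Completeness.  A global history is fired in the net from the configuration of the
   last non-cut-off i-event [k].  If this is blocked, the configuration reached contains
   a candidate [e], and the common past of [k] and [e] lies below its witness [e'].
   Hence [[k]] and [e], and [[k]] and [e'], generate configurations with the same
   global state, and exchanging them gives a shorter history of no larger weight.

   Termination.  Only finitely many i-events are not cut-offs.  In an infinite run,
   a Koenig argument (an event enabled at a configuration is determined by its label)
   yields an infinite configuration, hence an infinite causal chain in one component.
   The set of components aware of the l-th element of the chain eventually
   stabilises, which makes all sufficiently distant pairs of elements comparable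
   for <<.  By the pigeonhole principle two of them make the later one a candidate
   that is never freed, although the chain continues above it. *)

Set Implicit Arguments.
Unset Strict Implicit.
Unset Printing Implicit Defensive.

Import Order.TTheory GRing.Theory Num.Theory.

(** * Occurrence nets, configurations and their markings *)

Section Nets.
Variables (Sig : finType) (R : realType) (n : nat) (A : 'I_n -> wlts Sig R).
Implicit Types (N X : net A) (C D : pred nat) (b : cond n) (t : gtrans A).

Definition past N (e : nat) : pred nat := fun k => `[< inconf N e k >].

(** For a downward closed set, absence of conflict amounts to no condition being consumed twice;
    this form makes no mention of causal paths. *)
Definition conf N C : Prop :=
  [/\ forall k, C k -> k < size N,
      forall k a j, C k -> (Some a, j) \in evpre N k -> C a &
      forall k k' b, C k -> C k' -> b \in evpre N k -> b \in evpre N k' -> k = k'].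

(** The cut of [C]; for [C = [e]] it is M(e), as [inM_mark] shows. *)
Definition mark N C b : Prop :=
  isCond N b /\ (if b.1 is Some k then C k else true) /\
  ~ (exists k, C k /\ b \in evpre N k).

Definition addev C (k : nat) : pred nat := fun x => C x || (x == k).

(** The properties of branching processes on which the proof rests, all kept by possible extensions
    ([occurrence_rcons]). [occ_index] makes the order of addition a linearisation of causality;
    [occ_ext] says that label and preset determine an event; [occ_conf] excludes self-conflict and
    stands in for reachability. *)
Record occurrence_net N : Prop := OccurrenceNet {
  occ_valid : forall k t, evlab N k = Some t -> gvalid t;
  occ_index : forall k a j, (Some a, j) \in evpre N k -> a < k;
  occ_isCond : forall k b, b \in evpre N k -> isCond N b;
  occ_pre : forall k t j, evlab N k = Some t ->
    if t.2 j is Some p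
    then exists b, [/\ b \in evpre N k, b.2 = j & condlab N b = Some (Tagged (@lstate _ _ _ A) p.1)]
    else forall b, b \in evpre N k -> b.2 <> j;
  occ_pre_inj : forall k b b', b \in evpre N k -> b' \in evpre N k -> b.2 = b'.2 -> b = b';
  occ_ext : forall k k' t, evlab N k = Some t -> evlab N k' = Some t ->
    evpre N k =i evpre N k' -> k = k';
  occ_conf : forall k, k < size N -> exists2 C, conf N C & C k }.

Lemma evlab_lt N k t : evlab N k = Some t -> k < size N.
Proof. by rewrite /evlab -onthTE; case: (onth N k). Qed.

Lemma evlabP N k : k < size N -> exists t, evlab N k = Some t.
Proof. by rewrite -onthTE /evlab; case: (onth N k) => // e _; exists e.1. Qed.

Lemma partb_lt N k j : partb N k j -> k < size N.
Proof. by rewrite /partb; case E: (evlab N k) => [t|] // _; apply: evlab_lt E. Qed.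

Lemma evpre_lt N k b : b \in evpre N k -> k < size N.
Proof. by rewrite /evpre -onthTE; case: (onth N k). Qed.

Lemma partbE N k t j : evlab N k = Some t -> partb N k j = (t.2 j != None).
Proof. by rewrite /partb => ->. Qed.

Lemma arc_pre N b k : b \in evpre N k -> Defs.arc N (inl b) (inr k).
Proof. by move=> h; split=> //; apply: evpre_lt h. Qed.

Lemma nle_trans N x y z : nle N x y -> nle N y z -> nle N x z.
Proof.
case=> [->//|xy] [<-|yz]; first by right.
by right; apply: t_trans xy yz.
Qed.

Lemma nlt_nle_trans N x y z : nlt N x y -> nle N y z -> nlt N x z.
Proof. by move=> xy [<-//|]; apply: t_trans xy. Qed.

Lemma nlt_inv_last N x y : nlt N x y ->
  exists2 z, nle N x z & Defs.arc N z y.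
Proof.
move=> h; case: y / {h}(clos_trans_tn1 _ _ _ _ h) => [y' xy|z y' zy xz]; first by exists x => //; left.
by exists z => //; right; apply: clos_tn1_trans.
Qed.

Lemma nlt_inv_first N x y : nlt N x y ->
  exists2 z, Defs.arc N x z & nle N z y.
Proof.
move=> h; case: y / {h}(clos_trans_t1n _ _ _ _ h) => [y' xy|z y' xz zy]; first by exists y' => //; left.
by exists z => //; right; apply: clos_t1n_trans.
Qed.

Lemma nlt_event_first N k e : nlt N (inr k) (inr e) ->
  exists j g, [/\ partb N k j, (Some k, j) \in evpre N g & nle N (inr g) (inr e)].
Proof.
case/nlt_inv_first => -[[a j]|//] [/= -> kj]; case=> [//|].
by case/nlt_inv_first => -[//|g] [_ kg] ge; exists j, g.
Qed.

Lemma nlt_event_last N k e : nlt N (inr k) (inr e) ->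
  exists a j, (Some a, j) \in evpre N e /\ nle N (inr k) (inr a).
Proof.
case/nlt_inv_last => -[[o j]|a] ka [] // lte oe.
case: ka => // /nlt_inv_last [] [//|a] ka [/= ao aj].
by exists a, j; rewrite -ao.
Qed.

(** A path between conditions must leave [b'] through a consumer and enter [b] through its producer.
    The relation [<<] is verified and exploited in this form. *)
Lemma nlt_condE N b' b : nlt N (inl b') (inl b) <->
  exists g k, [/\ b.1 = Some g, partb N g b.2, b' \in evpre N k & nle N (inr k) (inr g)].
Proof.
split=> [/nlt_inv_last[] [//|g] b'g [bg gj]|].
  exists g; case: b'g => // /nlt_inv_first [] [//|k] [_ b'k] kg.
  by exists k.
case=> g [k [bg gj b'k kg]].
apply: (nlt_nle_trans (t_step _ _ _ _ (arc_pre b'k))).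
by apply: (nle_trans kg); right; apply: t_step.
Qed.

Section Occurrence.
Variables (N : net A) (oN : occurrence_net N).

Lemma nlt_pre a j e : (Some a, j) \in evpre N e -> nlt N (inr a) (inr e).
Proof.
move=> ae; have := occ_isCond oN ae; rewrite /isCond /= => aj.
by apply: (@t_trans _ _ _ (inl (Some a, j))); apply: t_step => //; apply: arc_pre.
Qed.

Lemma nlt_index k e : nlt N (inr k) (inr e) -> k < e.
Proof.
elim/ltn_ind: e => e IH /nlt_event_last [a [j [/(occ_index oN) ae]]].
by case=> [[->]//|/(IH _ ae) ka]; apply: ltn_trans ae.
Qed.

Lemma pastP e k : reflect (k < size N /\ nle N (inr k) (inr e)) (past N e k).
Proof. exact: asboolP. Qed.

Lemma past_size e k : past N e k -> k < size N.
Proof. by case/pastP. Qed.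

Lemma past_leq e k : past N e k -> k <= e.
Proof. by case/pastP => _ [[->]//|/nlt_index/ltnW]. Qed.

Lemma past_refl e : e < size N -> past N e e.
Proof. by move=> h; apply/pastP; split=> //; left. Qed.

Lemma past_trans f e g : past N e f -> past N f g -> past N e g.
Proof.
case/pastP=> _ fe /pastP[gN gf]; apply/pastP; split=> //; exact: nle_trans gf fe.
Qed.

Lemma nlt_past k e : nlt N (inr k) (inr e) <-> past N e k /\ k <> e.
Proof.
split=> [ke|[/pastP[_ [[->]//|]]//]].
split; last by move=> E; have := nlt_index ke; rewrite E ltnn.
apply/pastP; split; last by right.
by have [j [g [/partb_lt]]] := nlt_event_first ke.
Qed.

Lemma past_pre e a j : (Some a, j) \in evpre N e -> past N e a.
Proof. by move=> /nlt_pre /nlt_past[]. Qed.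

Lemma past_pre_trans e f a j : past N e f -> (Some a, j) \in evpre N f -> past N e a.
Proof. by move=> ef /past_pre; apply: past_trans. Qed.

Lemma past_last e k : past N e k ->
  k = e \/ exists a j, (Some a, j) \in evpre N e /\ past N a k.
Proof.
case/pastP=> kN [[->]|/nlt_event_last[a [j [ae ka]]]]; first by left.
by right; exists a, j; split=> //; apply/pastP.
Qed.

Lemma past_first e k : past N e k ->
  k = e \/ exists j g, [/\ partb N k j, (Some k, j) \in evpre N g & past N e g].
Proof.
case/pastP=> kN [[->]|/nlt_event_first[j [g [kj kg ge]]]]; first by left.
by right; exists j, g; split=> //; apply/pastP; split=> //; apply: evpre_lt kg.
Qed.

Lemma conf_past C e k : conf N C -> C e -> past N e k -> C k.
Proof.
move=> [_ dC _]; elim/ltn_ind: e => e IH Ce /past_last[->//|[a [j [ae]]]].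
by apply: IH; [exact: occ_index oN _ _ _ ae | exact: dC Ce ae].
Qed.

Lemma past_conf e : e < size N -> conf N (past N e).
Proof.
move=> /(occ_conf oN)[C cC Ce]; have [_ _ fC] := cC; split.
- by move=> k /past_size.
- by move=> k a j; apply: past_pre_trans.
- by move=> k k' b /(conf_past cC Ce) Ck /(conf_past cC Ce); apply: fC.
Qed.

Lemma conf0 : conf N pred0. Proof. by split. Qed.

(** Presets refer to smaller indices, so truncation at an index keeps downward closure. This allows
    induction on a configuration one index at a time. *)
Lemma conf_leq C m : conf N C -> conf N (fun k => C k && (k < m)).
Proof.
move=> [sC dC fC]; split.
- by move=> k /andP[/sC].
- move=> k a j /andP[Ck km] ak; rewrite (dC _ _ _ Ck ak) /=.
  exact: ltn_trans (occ_index oN ak) km.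
- by move=> k k' b /andP[Ck _] /andP[Ck' _]; apply: fC.
Qed.

Lemma conf_sub C D : conf N C -> (forall k, D k -> C k) ->
  (forall k a j, D k -> (Some a, j) \in evpre N k -> D a) -> conf N D.
Proof.
move=> [sC dC fC] DC dD; split=> //; first by move=> k /DC/sC.
by move=> k k' b /DC Ck /DC; apply: fC.
Qed.

Lemma conf_unionl C D E : conf N C -> conf N D -> conf N E ->
  (forall k, D k -> C k) -> (forall k, E k -> C k) -> conf N (fun k => D k || E k).
Proof.
move=> cC [_ dD _] [_ dE _] DC EC; apply: (conf_sub cC) => k.
  by case/orP=> [/DC|/EC].
move=> a j /orP[/dD h|/dE h] /h ->//; exact: orbT.
Qed.

Lemma pre_part k b : b \in evpre N k -> partb N k b.2.
Proof.
move=> bk; have [t lt] := evlabP (evpre_lt bk); rewrite (partbE _ lt).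
by have := occ_pre oN b.2 lt; case: (t.2 b.2) => // /(_ _ bk).
Qed.

Lemma part_pre k j : partb N k j -> exists2 b, b \in evpre N k & b.2 = j.
Proof.
move=> kj; have [t lt] := evlabP (partb_lt kj).
move: kj; rewrite (partbE _ lt); have := occ_pre oN j lt.
by case: (t.2 j) => // p [b [bk bj _]] _; exists b.
Qed.

Lemma event_part k : k < size N -> exists j, partb N k j.
Proof.
case/evlabP=> t lt; have [[j tj] _] := occ_valid oN lt.
by exists j; rewrite (partbE _ lt).
Qed.

(* A configuration has at most one marked condition per component, so firing
   [k] replaces exactly the conditions of the participating components. *)
Lemma mark_addev C k b : conf N C -> conf N (addev C k) -> ~~ C k ->
  (forall b b', mark N C b -> mark N C b' -> b.2 = b'.2 -> b = b') ->
  mark N (addev C k) b <-> if partb N k b.2 then b = (Some k, b.2) else mark N C b.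
Proof.
move=> cC cCk nCk uC; have [sCk dCk fCk] := cCk; have [sC dC _] := cC.
have Ckk : addev C k k by rewrite /addev eqxx orbT.
have nself j : (Some k, j) \notin evpre N k.
  by apply/negP=> /(occ_index oN); rewrite ltnn.
have pre_mark b' : b' \in evpre N k -> mark N C b'.
  move=> b'k; split; first exact: occ_isCond oN _ _ b'k.
  split.
    case: b' b'k => [[a|] j] //= ak.
    have := dCk _ _ _ Ckk ak; rewrite /addev => /orP[//|/eqP ak'].
    by have := occ_index oN ak; rewrite ak' ltnn.
  case=> k' [Ck' b'k']; have Ck'' : addev C k k' by rewrite /addev Ck'.
  by move: nCk; rewrite -(fCk _ _ _ Ck'' Ckk b'k' b'k) Ck'.
case: ifPn => [kj|nkj].
- split=> [mb|->]; last first.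
    split=> //; split=> /=; first exact: Ckk.
    case=> k' [/orP[Ck'|/eqP->]]; last by apply/negP.
    by move=> /(dC _ _ _ Ck'); apply/negP.
  have [ib [pb nb]] := mb.
  have [b' b'k b'j] := part_pre kj.
  case: (eqVneq b.1 (Some k)) => [<-|bk]; first by case: (b).
  have mb' : mark N C b.
    split=> //; split.
      case: (b.1) pb bk => // a /orP[//|/eqP->]; by rewrite eqxx.
    by case=> k' [Ck' bk']; apply: nb; exists k'; rewrite /addev Ck'.
  case: nb; exists k; split=> //.
  by rewrite (uC _ _ mb' (pre_mark _ b'k) (esym b'j)).
- split=> -[ib [pb nb]]; split=> //; split.
  + case E: b.1 ib pb => [a|] // ib /orP[//|/eqP ak].
    by move: ib; rewrite /isCond E ak (negbTE nkj).
  + by case=> k' [Ck' bk']; apply: nb; exists k'; rewrite /addev Ck'.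
  + by case: (b.1) pb => // a; rewrite /addev => ->.
  + case=> k' [/orP[Ck'|/eqP->] bk']; first by apply: nb; exists k'.
    by move: nkj; rewrite (pre_part bk').
Qed.

End Occurrence.

(** As the index order linearises causality, the marked condition of a component is the output of
    its last event in the configuration. The bound [m] supports induction; [mark_mkn] proves the
    agreement with [mark]. *)
Fixpoint mkn N C (m : nat) (j : 'I_n) : cond n :=
  if m is m'.+1 then
    if C m' && partb N m' j then (Some m', j) else mkn N C m' j
  else (None, j).

Definition fire t (s : gstate A) : gstate A :=
  [ffun j => if t.2 j is Some p then p.2 else s j].

Fixpoint stn N C (m : nat) : gstate A :=
  if m is m'.+1 then
    if C m' then (if evlab N m' is Some t then fire t (stn N C m') else stn N C m')
    else stn N C m'
  else ginit A.

Definition mk N C := mkn N C (size N).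
Definition st N C := stn N C (size N).

Lemma mkn2 N C m j : (mkn N C m j).2 = j.
Proof. by elim: m => //= m IH; case: ifP. Qed.

Lemma mkn_some N C m j k : (mkn N C m j).1 = Some k -> [/\ C k, partb N k j & k < m].
Proof.
elim: m => //= m IH; case: ifP => [/andP[Cm mj] [<-]|_ /IH[]] //.
by move=> Ck kj km; split=> //; apply: ltnW.
Qed.

Lemma mkn_max N C m j k : C k -> partb N k j -> k < m ->
  exists2 k', mkn N C m j = (Some k', j) & k <= k'.
Proof.
move=> Ck kj; elim: m => //= m IH; rewrite ltnS leq_eqVlt => /orP[/eqP<-|km].
  by rewrite Ck kj; exists k.
case: ifP => _; first by exists m => //; apply: ltnW.
exact: IH.
Qed.

Lemma condlab_mkn N C m j : m <= size N ->
  condlab N (mkn N C m j) = Some (Tagged (@lstate _ _ _ A) (stn N C m j)).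
Proof.
elim: m => [|m IH] mN; first by rewrite /= /ginit ffunE.
move: (IH (ltnW mN)) => {}IH /=; have [t lt] := evlabP mN.
rewrite lt (partbE _ lt); case: (C m) => //=.
rewrite ffunE /=; case E: (t.2 j) => [p|] //=.
by rewrite lt E.
Qed.

Section Marking.
Variables (N : net A) (oN : occurrence_net N).

Lemma addev_leq C m : C m -> (fun k => C k && (k < m.+1)) = addev (fun k => C k && (k < m)) m.
Proof.
move=> Cm; apply: funext => k; rewrite /addev ltnS leq_eqVlt andb_orr orbC.
by case: eqP => [->|]; rewrite ?Cm ?andbF.
Qed.

Lemma leq_skip C m : ~~ C m -> (fun k => C k && (k < m.+1)) = (fun k => C k && (k < m)).
Proof.
move=> Cm; apply: funext => k; rewrite ltnS leq_eqVlt.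
by case: eqP => [->|]; rewrite ?(negbTE Cm).
Qed.

(** Index [m] is either skipped or fired; when it is fired, [mark_addev] applies, its uniqueness
    premise being supplied by the induction hypothesis. *)
Lemma mark_mkn C m b : conf N C ->
  mark N (fun k => C k && (k < m)) b <-> b = mkn N C m b.2.
Proof.
move=> cC; elim: m b => [|m IH] b.
  split=> [[_ [pb _]]|->].
    by case: b pb => [[a|] j] //=; rewrite andbF.
  by split=> //; split=> // -[k []]; rewrite andbF.
have uC b1 b2 : mark N (fun k => C k && (k < m)) b1 ->
    mark N (fun k => C k && (k < m)) b2 -> b1.2 = b2.2 -> b1 = b2.
  by move=> /IH e1 /IH e2 e; rewrite e1 e2 e.
have [Cm|Cm] := boolP (C m); last by rewrite leq_skip //= (negbTE Cm).
rewrite addev_leq // /= Cm /=.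
have cm := conf_leq oN m cC; have cm1 := conf_leq oN m.+1 cC.
rewrite addev_leq // in cm1.
rewrite (mark_addev oN b cm cm1 _ uC) ?ltnn ?andbF //.
by case: ifP.
Qed.

Lemma conf_all C : conf N C -> (fun k => C k && (k < size N)) = C.
Proof. by case=> sC _ _; apply: funext => k; apply: andb_idr => /sC. Qed.

Lemma markP C b : conf N C -> mark N C b <-> b = mk N C b.2.
Proof. by move=> cC; rewrite -(mark_mkn _ _ cC) conf_all. Qed.

Lemma mark_mk C j : conf N C -> mark N C (mk N C j).
Proof. by move=> cC; apply/markP => //; rewrite /mk mkn2. Qed.

Lemma mark_uniq C b b' : conf N C -> mark N C b -> mark N C b' -> b.2 = b'.2 -> b = b'.
Proof. by move=> cC /(markP _ cC) e1 /(markP _ cC) e2 e; rewrite e1 e2 e. Qed.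

Lemma condlab_mk C j : condlab N (mk N C j) = Some (Tagged (@lstate _ _ _ A) (st N C j)).
Proof. exact: condlab_mkn. Qed.

Lemma mk_addev C k j : conf N C -> conf N (addev C k) -> ~~ C k ->
  mk N (addev C k) j = if partb N k j then (Some k, j) else mk N C j.
Proof.
move=> cC cCk nCk.
have E := mark_addev oN (mk N (addev C k) j) cC cCk nCk (fun b b' => @mark_uniq C b b' cC).
move/E: (mark_mk j cCk); rewrite {1 3}/mk mkn2; case: ifP => // _ /(markP _ cC).
by rewrite {2}/mk mkn2.
Qed.

(** Were this condition not consumed by [k], it would stay marked after [k], whereas [mark_addev]
    leaves only [(Some k, j)] marked in component [j], and [k] is not in [C]. *)
Lemma pre_mk C k j : conf N C -> conf N (addev C k) -> ~~ C k -> partb N k j ->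
  mk N C j \in evpre N k.
Proof.
move=> cC cCk nCk kj; have [_ _ fCk] := cCk; have [_ dC _] := cC.
have := mark_addev oN (mk N C j) cC cCk nCk (fun b b' => @mark_uniq C b b' cC).
rewrite {2}/mk mkn2 kj => -[h _].
apply: contrapT => nk; have [ib [pb nb]] := mark_mk j cC.
suff /h E : mark N (addev C k) (mk N C j).
  by move: pb nCk; rewrite E /= => ->.
split=> //; split; first by case: ((mk N C j).1) pb => // a; rewrite /addev => ->.
case=> k' [/orP[Ck'|/eqP->//] bk']; by apply: nb; exists k'.
Qed.

Lemma st_inj C D : (forall j, condlab N (mk N C j) = condlab N (mk N D j)) -> st N C = st N D.
Proof.
move=> h; apply/ffunP => j; have := h j; rewrite !condlab_mk => -[].
exact: eq_from_Tagged.
Qed.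

Lemma st_addev C k t : conf N C -> conf N (addev C k) -> ~~ C k ->
  evlab N k = Some t -> gstep (st N C) t (st N (addev C k)).
Proof.
move=> cC cCk nCk lk; split; first exact: occ_valid oN _ _ lk.
move=> j; have := condlab_mk (addev C k) j; rewrite (mk_addev _ cC cCk nCk).
have := partbE j lk; have := occ_pre oN j lk; case E: (t.2 j) => [p|] /=.
  case=> b [bk bj lb] kj; rewrite kj /= lk E => stE; have {}stE := eq_from_Tagged (Some_inj stE); split=> //.
  have bE : b = mk N C j.
    apply: (occ_pre_inj oN bk); last by rewrite /mk mkn2.
    exact: pre_mk.
  by move: lb; rewrite bE condlab_mk => lb; exact: eq_from_Tagged (Some_inj lb).
by move=> _ ->; rewrite condlab_mk => stE; rewrite (eq_from_Tagged (Some_inj stE)).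
Qed.

End Marking.
End Nets.

(** * Configurations as runs of the composition *)

Section Runs.
Variables (Sig : finType) (R : realType) (n : nat) (A : 'I_n -> wlts Sig R).
Implicit Types (N X : net A) (C D : pred nat) (b : cond n) (t : gtrans A).

Lemma gstep_fire (s s' : gstate A) t : gstep s t s' -> s' = fire t s.
Proof.
move=> [_ h]; apply/ffunP => j; rewrite ffunE; have := h j.
by case: (t.2 j) => [p []|].
Qed.

Definition endst (s : gstate A) (h : seq (gtrans A)) := foldl (fun s t => fire t s) s h.

Lemma endst_cat (s : gstate A) h1 h2 : endst s (h1 ++ h2) = endst (endst s h1) h2.
Proof. exact: foldl_cat. Qed.

Lemma run_cat (s : gstate A) h1 h2 :
  run (@gstep _ _ _ A) s (h1 ++ h2) <->
  run (@gstep _ _ _ A) s h1 /\ run (@gstep _ _ _ A) (endst s h1) h2.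
Proof.
elim: h1 s => [|t h1 IH] s /=; first by split=> // -[].
split=> [[s' [st /IH[r1 r2]]]|[[s' [st r1]] r2]].
  by rewrite -(gstep_fire st); split=> //; exists s'.
by exists s'; split=> //; apply/IH; split=> //; rewrite (gstep_fire st).
Qed.

Definition labs N (s : seq nat) := pmap (evlab N) s.
(** For configurations [C] inside [C'], listing by increasing index makes this a firing order from
    [C] to [C']. *)
Definition diff N C C' := [seq k <- iota 0 (size N) | C' k && ~~ C k].

Lemma mem_diff N C C' k : conf N C' -> (k \in diff N C C') = C' k && ~~ C k.
Proof.
move=> [sC _ _]; rewrite mem_filter mem_iota /=; apply: andb_idr => /andP[/sC].
by rewrite add0n.
Qed.

Lemma conf_addev N C k : conf N C -> k < size N ->
  (forall b, b \in evpre N k -> mark N C b) -> conf N (addev C k).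
Proof.
move=> [sC dC fC] kN mk; split.
- by move=> x /orP[/sC|/eqP->].
- move=> x a j /orP[Cx ax|/eqP-> ak]; rewrite /addev ?(dC _ _ _ Cx ax) //.
  by have [_ [/= -> _]] := mk _ ak.
- move=> x y b /orP[Cx|/eqP->] /orP[Cy|/eqP->] //; first exact: fC.
  + by move=> bx /mk[_ [_ []]]; exists x.
  + by move=> /mk[_ [_ nb]] bk; case: nb; exists y.
Qed.

Section Occ.
Variables (N : net A) (oN : occurrence_net N).

(** Strong induction on [h]: the condition of component [j] that [h] consumes comes from the last
    event of [j] in [C] before [h], which has index at least [g]. Hence within a configuration the
    events of one component form a causal chain. *)
Lemma part_total C g h j : conf N C -> C g -> C h ->
  partb N g j -> partb N h j -> g <= h -> past N h g.
Proof.
move=> cC Cg; elim/ltn_ind: h => h IH Ch gj hj; rewrite leq_eqVlt.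
have hN : h < size N by apply: partb_lt hj.
case/orP=> [/eqP->|gh]; first exact: past_refl.
have ch := conf_leq oN h cC; have := conf_leq oN h.+1 cC.
rewrite addev_leq // => ch1.
have nh : ~~ (C h && (h < h)) by rewrite ltnn andbF.
have := pre_mk oN ch ch1 nh hj.
have Cg' : C g && (g < h) by rewrite Cg.
have [k kE gk] := @mkn_max _ _ _ _ N (fun k => C k && (k < h)) (size N) j g Cg' gj (partb_lt gj).
have [/andP[Ck kh] kj _] : [/\ C k && (k < h), partb N k j & k < size N].
  by apply: (@mkn_some _ _ _ _ N (fun k => C k && (k < h)) (size N) j k); rewrite kE.
rewrite /mk kE => /(past_pre oN) hk; apply: past_trans hk _; exact: IH.
Qed.

Lemma mk_past_self e j : partb N e j -> mk N (past N e) j = (Some e, j).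
Proof.
move=> ej; have eN := partb_lt ej; have ee := past_refl eN.
have [k kE ek] := @mkn_max _ _ _ _ N (past N e) (size N) j e ee ej eN.
have [ek' _ _] : [/\ past N e k, partb N k j & k < size N].
  by apply: (@mkn_some _ _ _ _ N (past N e) (size N) j k); rewrite kE.
rewrite /mk kE; congr (Some _, _); apply/eqP; rewrite eqn_leq ek andbT.
exact: past_leq ek'.
Qed.

Lemma conf_run C C' : conf N C -> conf N C' -> (forall k, C k -> C' k) ->
  run (@gstep _ _ _ A) (st N C) (labs N (diff N C C')) /\
  endst (st N C) (labs N (diff N C C')) = st N C'.
Proof.
move=> cC cC' CC'.
pose Cm m k := C k || (C' k && (k < m)).
have cCm m : conf N (Cm m).
  by apply: (conf_unionl cC' cC (conf_leq oN m cC')) => // k /andP[].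
suff H m : m <= size N ->
    let s := [seq k <- iota 0 m | C' k && ~~ C k] in
    run (@gstep _ _ _ A) (st N C) (labs N s) /\ endst (st N C) (labs N s) = st N (Cm m).
  have := H _ (leqnn _) => /= -[h1 h2]; split=> //; rewrite [LHS]h2; congr (st N _).
  apply: funext => k; rewrite /Cm; have [sC' _ _] := cC'.
  by apply/orP/idP => [[/CC'|/andP[]]//|Ck]; right; rewrite Ck sC'.
elim: m => [_|m IH mN].
  by split=> //=; congr (st N _); apply: funext => k; rewrite /Cm andbF orbF.
case: (IH (ltnW mN)); lazy zeta => h1 h2.
rewrite -[m.+1]addn1 iotaD add0n filter_cat /labs pmap_cat -/(labs _ _) /=.
have [/andP[C'm nCm]|nm] := ifPn.
  have E : Cm (m + 1) = addev (Cm m) m.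
    apply: funext => k; rewrite /Cm /addev addn1 ltnS leq_eqVlt andb_orr -!orbA.
    congr orb; rewrite orbC; congr orb.
    by case: eqP => [->|]; rewrite ?C'm ?andbF.
  have [t lt] := evlabP mN.
  have nCmm : ~~ Cm m m by rewrite /Cm ltnn andbF orbF.
  have := st_addev oN (cCm m) _ nCmm lt; rewrite -E => /(_ (cCm _)) step.
  rewrite /= lt /=; split; last by rewrite endst_cat h2 /= (gstep_fire step).
  by apply/run_cat; split=> //=; rewrite h2; exists (st N (Cm (m + 1))).
rewrite /= cats0; split=> //; rewrite h2; congr (st N _); apply: funext => k.
rewrite /Cm addn1 ltnS (leq_eqVlt k); case: eqP => [->|//]; rewrite ltnn andbF orbF andbT.
by move: nm; rewrite negb_and negbK; case: (C' m) => //=; rewrite ?orbF // => ->.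
Qed.

Lemma mark_notin C k : k < size N ->
  (forall b, b \in evpre N k -> mark N C b) -> ~~ C k.
Proof.
move=> kN mk; have [j /(part_pre oN)[b bk _]] := event_part oN kN.
by apply/negP => Ck; have [_ [_ []]] := mk _ bk; exists k.
Qed.

Lemma mem_post k b : (b \in post N k) = partb N k b.2 && (b.1 == Some k).
Proof.
apply/mapP/andP => [[j]|[kj /eqP bk]].
  by rewrite mem_filter => /andP[kj _] ->.
by exists b.2; [rewrite mem_filter kj mem_enum | rewrite -bk; case: (b)].
Qed.

Lemma fire_marking C k (m : seq (cond n)) : conf N C -> conf N (addev C k) -> ~~ C k ->
  (forall b, b \in m <-> mark N C b) ->
  forall b, b \in [seq b <- m | b \notin evpre N k] ++ post N k <-> mark N (addev C k) b.
Proof.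
move=> cC cCk nCk mE b.
rewrite (mark_addev oN b cC cCk nCk (fun b b' => @mark_uniq _ _ _ _ N oN C b b' cC)).
rewrite mem_cat mem_filter mem_post; case: ifPn => kj /=.
  split=> [/orP[/andP[bk /mE /(markP oN _ cC) bE]|/eqP<-]|bE].
  - by move: bk; rewrite bE (pre_mk oN cC cCk nCk kj).
  - by case: (b).
  - by rewrite bE eqxx orbT.
rewrite orbF; split=> [/andP[_ /mE]//|/mE ->]; rewrite andbT.
by apply/negP => /(pre_part oN); apply/negP.
Qed.

(** With [conf_reachable], reachable markings are exactly the cuts of configurations, which turns
    the reachability premise of [pext] into a statement about configurations. *)
Lemma reachable_conf m : reachable N m ->
  exists2 C, conf N C & forall b, b \in m <-> mark N C b.
Proof.
elim=> [|m' k _ [C cC mE] kN /allP en].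
  exists pred0 => [|b]; first exact: conf0.
  split=> [/mapP[j _ ->]|[_ [pb _]]]; first by split=> //; split=> // -[k []].
  by apply/mapP; exists b.2; rewrite ?mem_enum //; case: b pb => [[]].
have mk b : b \in evpre N k -> mark N C b by move=> /en /= /mE.
have nCk := mark_notin kN mk; have cCk := conf_addev cC kN mk.
by exists (addev C k) => //; apply: fire_marking.
Qed.

Lemma conf_reachable C : conf N C ->
  exists2 m, reachable N m & forall b, b \in m <-> mark N C b.
Proof.
move=> cC; rewrite -(conf_all cC); elim: (size N) => [|m [mm rm mE]].
  exists (minit n); first exact: reach0.
  move=> b; split=> [/mapP[j _ ->]|[_ [pb _]]].
    by split=> //; split=> // -[k []]; rewrite andbF.
  by apply/mapP; exists b.2; rewrite ?mem_enum //; case: b pb => [[a|]] //=; rewrite andbF.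
have [Cm|Cm] := boolP (C m); last by exists mm; rewrite ?leq_skip.
have cm := conf_leq oN m cC; have cm1 := conf_leq oN m.+1 cC.
rewrite addev_leq // in cm1 *.
have nm : ~~ (C m && (m < m)) by rewrite ltnn andbF.
exists ([seq b <- mm | b \notin evpre N m] ++ post N m); last exact: fire_marking.
apply: reachS => //; first by case: cC => sC _ _; apply: sC.
apply/allP => b bm; apply/mE/(markP oN _ cm).
apply: (occ_pre_inj oN bm); last by rewrite /mk mkn2.
by apply: (pre_mk oN cm cm1 nm); exact: pre_part bm.
Qed.

End Occ.

(** * Stability of the data of old events under added events *)

Section Extension.
Variables (N X : net A).

Lemma evlab_cat k : k < size N -> evlab (N ++ X) k = evlab N k.
Proof. by move=> kN; rewrite /evlab onth_cat kN. Qed.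

Lemma evpre_cat k : k < size N -> evpre (N ++ X) k = evpre N k.
Proof. by move=> kN; rewrite /evpre onth_cat kN. Qed.

Lemma partb_cat k j : k < size N -> partb (N ++ X) k j = partb N k j.
Proof. by move=> kN; rewrite /partb evlab_cat. Qed.

Lemma ltn_size_cat k : k < size N -> k < size (N ++ X).
Proof. by move=> kN; rewrite size_cat ltn_addr. Qed.

Definition cond_in b := if b.1 is Some k then k < size N else true.

Lemma isCond_in b : isCond N b -> cond_in b.
Proof. by rewrite /isCond /cond_in; case: (b.1) => // k; apply: partb_lt. Qed.

Lemma isCond_cat b : cond_in b -> isCond (N ++ X) b = isCond N b.
Proof.
by rewrite /isCond /cond_in; case: (b.1) => // k kN; rewrite partb_cat.
Qed.

Lemma condlab_cat b : cond_in b -> condlab (N ++ X) b = condlab N b.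
Proof. by rewrite /cond_in; case: b => [[k|] j] //= kN; rewrite evlab_cat. Qed.

Lemma conf_cat C : (forall k, C k -> k < size N) -> conf (N ++ X) C <-> conf N C.
Proof.
move=> CN; split=> [[_ dC fC]|[_ dC fC]]; split=> //.
- move=> k a j Ck ak; apply: (dC _ _ j Ck); by rewrite evpre_cat ?CN.
- by move=> k k' b Ck Ck' bk bk'; apply: (fC _ _ b Ck Ck'); rewrite evpre_cat ?CN.
- by move=> k /CN/ltn_size_cat.
- by move=> k a j Ck; rewrite evpre_cat ?CN //; exact: dC.
- by move=> k k' b Ck Ck'; rewrite !evpre_cat ?CN //; exact: fC.
Qed.

Lemma mark_cat C b : (forall k, C k -> k < size N) -> mark (N ++ X) C b <-> mark N C b.
Proof.
move=> CN.
have H : (if b.1 is Some k then is_true (C k) else is_true true) -> isCond (N ++ X) b = isCond N b.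
  by move=> pb; apply: isCond_cat; rewrite /cond_in; move: pb; case: (b.1) => // k; exact: CN.
split=> -[ib [pb nb]].
  rewrite (H pb) in ib; split=> //; split=> // -[k [Ck bk]]; apply: nb; exists k.
  by rewrite evpre_cat ?CN.
split; first by rewrite (H pb).
split=> // -[k [Ck]]; rewrite evpre_cat ?CN // => bk; apply: nb; by exists k.
Qed.

Lemma mkn_cat C m j : m <= size N -> mkn (N ++ X) C m j = mkn N C m j.
Proof. by elim: m => //= m IH mN; rewrite partb_cat // IH // ltnW. Qed.

Lemma stn_cat C m : m <= size N -> stn (N ++ X) C m = stn N C m.
Proof. by elim: m => //= m IH mN; rewrite evlab_cat // IH // ltnW. Qed.

Lemma mk_cat C j : (forall k, C k -> k < size N) -> mk (N ++ X) C j = mk N C j.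
Proof.
move=> CN; rewrite /mk size_cat; elim: (size X) => [|m IH]; first by rewrite addn0 mkn_cat.
rewrite addnS /= IH; case CE: (C _) => //=; have := CN _ CE.
by rewrite ltnNge leq_addr.
Qed.

Lemma st_cat C : (forall k, C k -> k < size N) -> st (N ++ X) C = st N C.
Proof.
move=> CN; rewrite /st size_cat; elim: (size X) => [|m IH]; first by rewrite addn0 stn_cat.
rewrite addnS /= IH; case CE: (C _) => //=; have := CN _ CE.
by rewrite ltnNge leq_addr.
Qed.

(** Descends through presets: those of old events are unchanged and contain only outputs of smaller,
    hence old, events. *)
Lemma past_cat e : occurrence_net N -> occurrence_net (N ++ X) -> e < size N ->
  past (N ++ X) e = past N e.
Proof.
move=> oN oNX; elim/ltn_ind: e => e IH eN.
apply: funext => k; apply/idP/idP.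
- case/(past_last)=> [->|[a [j []]]]; first exact: past_refl.
  rewrite evpre_cat // => ae; have lt := occ_index oN ae.
  by rewrite (IH _ lt (ltn_trans lt eN)); apply: past_trans (past_pre oN ae).
- case/(past_last)=> [->|[a [j []]]].
    by apply: past_refl; apply: ltn_size_cat.
  move=> ae; have lt := occ_index oN ae.
  rewrite -(IH _ lt (ltn_trans lt eN)); apply: past_trans.
  by apply: (@past_pre _ _ _ _ _ oNX e a j); rewrite evpre_cat.
Qed.

End Extension.

Lemma condlab_tag N b x : condlab N b = Some x -> tag x = b.2.
Proof.
case: b => [[k|] j] /=; last by case=> <-.
by case: (evlab N k) => // t; case: (t.2 j) => // p [<-].
Qed.

Lemma mem_pre_t t x : x \in pre_t t <->
  exists j p, t.2 j = Some p /\ x = Tagged (@lstate _ _ _ A) p.1.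
Proof.
rewrite /pre_t mem_pmap; split=> [/mapP[j _]|[j [p [tj ->]]]].
  by case E: (t.2 j) => [p|] //= [->]; exists j, p.
by apply/mapP; exists j; rewrite ?mem_enum // tj.
Qed.

Lemma uniq_pre_t t : uniq (map tag (pre_t t)).
Proof.
have -> : map tag (pre_t t) = [seq j <- enum 'I_n | t.2 j != None].
  rewrite /pre_t; elim: (enum 'I_n) => //= j s IH.
  by case: (t.2 j) => [p|] /=; rewrite IH.
exact/filter_uniq/enum_uniq.
Qed.

Section Pext.
Variables (N : net A) (t : gtrans A) (M : seq (cond n)).
Hypothesis lM : perm_eq (map (condlab N) M) (map Some (pre_t t)).

Lemma pext_lab b : b \in M -> exists j p, [/\ t.2 j = Some p, b.2 = j &
  condlab N b = Some (Tagged (@lstate _ _ _ A) p.1)].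
Proof.
move=> bM; have : condlab N b \in map Some (pre_t t).
  by rewrite -(perm_mem lM) map_f.
case/mapP=> x /mem_pre_t[j [p [tj ->]]] lb; exists j, p; split=> //.
by rewrite -(condlab_tag lb).
Qed.

Lemma pext_pre j p : t.2 j = Some p -> exists b, [/\ b \in M, b.2 = j &
  condlab N b = Some (Tagged (@lstate _ _ _ A) p.1)].
Proof.
move=> tj; have : Some (Tagged (@lstate _ _ _ A) p.1) \in map (condlab N) M.
  by rewrite (perm_mem lM) map_f //; apply/mem_pre_t; exists j, p.
by case/mapP=> b bM /esym lb; exists b; split=> //; rewrite -(condlab_tag lb).
Qed.

Lemma pext_inj b b' : b \in M -> b' \in M -> b.2 = b'.2 -> b = b'.
Proof.
have uM : uniq (map snd M).
  rewrite -(map_inj_uniq (@Some_inj _)).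
  have -> : map Some (map snd M) = map (omap tag) (map (condlab N) M).
    rewrite -!map_comp; apply/eq_in_map => c cM /=.
    by have [j [p [_ _ lc]]] := pext_lab cM; rewrite lc -(condlab_tag lc).
  rewrite (perm_uniq (perm_map _ lM)) -map_comp (map_comp Some tag).
  by rewrite (map_inj_uniq (@Some_inj _)) uniq_pre_t.
elim: M uM => //= c s IH /andP[cs us]; rewrite !inE.
move=> /orP[/eqP->|bs] /orP[/eqP->|bs'] //.
- by move=> e; case/negP: cs; rewrite e map_f.
- by move=> e; case/negP: cs; rewrite -e map_f.
- exact: IH.
Qed.

End Pext.

(** The marking containing [M] is the cut of a configuration [C]; adding the new event to [C] gives
    the configuration required by [occ_conf]. The last clause of [pext] gives [occ_ext]. *)
Lemma occurrence_rcons N t M : occurrence_net N -> pext N t M ->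
  occurrence_net (rcons N (t, M)).
Proof.
move=> oN [vt [[m [rm Mm]] [lM nd]]]; rewrite -cats1.
have [C cC mE] := reachable_conf oN rm.
have {mE}MC b : b \in M -> mark N C b by move=> /Mm/mE.
have CN k : C k -> k < size N by case: cC => sC _ _; apply: sC.
set X := [:: _].
have szX : size (N ++ X) = (size N).+1 by rewrite size_cat addn1.
have labX : evlab (N ++ X) (size N) = Some t by rewrite /evlab onth_cat ltnn subnn.
have preX : evpre (N ++ X) (size N) = M by rewrite /evpre onth_cat ltnn subnn.
have inN b : mark N C b -> cond_in N b by case=> /isCond_in.
have lt k : k < size (N ++ X) -> k < size N \/ k = size N.
  by rewrite szX ltnS leq_eqVlt => /orP[/eqP|]; auto.
have cinN k b : k < size N -> b \in evpre N k -> cond_in N b.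
  by move=> _ /(occ_isCond oN)/isCond_in.
split.
- move=> k t' l; have hk := lt _ (evlab_lt l); move: hk l => [kN|->]; last by rewrite labX => -[<-].
  by rewrite evlab_cat //; apply: occ_valid.
- move=> k a j ak; have hk := lt _ (evpre_lt ak); move: hk ak => [kN|->].
    by rewrite evpre_cat //; apply: occ_index.
  by rewrite preX => /MC[_ [/= /CN]].
- move=> k b bk; have hk := lt _ (evpre_lt bk); move: hk bk => [kN|->].
    rewrite evpre_cat // => bk; rewrite isCond_cat; first exact: occ_isCond oN _ _ bk.
    exact: cinN bk.
  by rewrite preX => /MC mb; rewrite isCond_cat ?inN //; case: mb.
- move=> k t' j l; have hk := lt _ (evlab_lt l); move: hk l => [kN|->].
    rewrite evlab_cat // evpre_cat // => l; have := occ_pre oN j l.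
    case: (t'.2 j) => // p [b [bk bj lb]]; exists b; split=> //.
    by rewrite condlab_cat //; apply: cinN bk.
  rewrite labX preX => -[<-]; case E: (t.2 j) => [p|].
    have [b [bM bj lb]] := pext_pre lM E; exists b; split=> //.
    by rewrite condlab_cat //; apply/inN/MC.
  move=> b /(pext_lab lM)[j' [p [tj' bj' _]]] e.
  have : t.2 j' != None by rewrite tj'.
  by rewrite -bj' e E.
- move=> k b b' bk; have hk := lt _ (evpre_lt bk); move: hk bk => [kN|->].
    by rewrite evpre_cat //; apply: occ_pre_inj.
  by rewrite preX; apply: pext_inj lM _ _.
- move=> k k' t' l l'.
  have hk' := lt _ (evlab_lt l'); have hk := lt _ (evlab_lt l).
  move: hk hk' l l' => [kN|->] [kN'|->] //.
  + by rewrite !evlab_cat // !evpre_cat // => l l'; apply: occ_ext oN _ _ _ l l'.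
  + rewrite labX preX evlab_cat // evpre_cat // => l [tE] E; case: nd; exists k.
    by rewrite tE.
  + rewrite labX preX evlab_cat // evpre_cat // => -[tE] l' E; case: nd; exists k'.
    by rewrite tE; split=> //; split=> // x; rewrite E.
- move=> k /lt[kN|->].
    have [C' cC' C'k] := occ_conf oN kN; exists C' => //; apply/conf_cat => //.
    by case: cC'.
  exists (addev C (size N)); last by rewrite /addev eqxx orbT.
  apply: conf_addev; rewrite ?szX //; first exact/conf_cat.
  by rewrite preX => b /MC mb; apply/mark_cat.
Qed.

Lemma occurrence_nil : occurrence_net ([::] : net A).
Proof.
have l k : evlab ([::] : net A) k = None by rewrite /evlab onth0n.
have p k : evpre ([::] : net A) k = [::] by rewrite /evpre onth0n.
by split=> [k t|k a j|k b|k t j|k b b'|k k' t|k]; rewrite ?l ?p.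
Qed.

End Runs.

(** * The invariant of Algorithm 2 *)

Section Invariant.
Variables (Sig : finType) (R : realType) (n : nat) (A : 'I_n -> wlts Sig R) (i : 'I_n).
Implicit Types (N X : net A) (C D : pred nat) (b : cond n) (t : gtrans A).

Definition conflict N (k e : nat) : Prop := exists (z : cond n) (k' e' : nat),
  [/\ k' <> e', z \in evpre N k', z \in evpre N e', past N k k' & past N e e'].

Section Occ.
Variables (N : net A) (oN : occurrence_net N).

Lemma inM_mark e b : inM N e b <-> mark N (past N e) b.
Proof.
split=> -[ib [pb nb]]; split=> //; split.
- by case: (b.1) pb => // k /asboolP.
- by case=> k [/asboolP ek bk]; apply: nb; exists k.
- by case: (b.1) pb => // k /asboolP.
- by case=> k [ek bk]; apply: nb; exists k; split=> //; apply/asboolP.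
Qed.

Lemma inM_mk e b : e < size N -> inM N e b <-> b = mk N (past N e) b.2.
Proof. by move=> eN; rewrite inM_mark (markP oN) //; apply: past_conf. Qed.

(** Labels are tagged by their component and each component is marked once, so equal sets of labels
    mean equal global states. *)
Lemma sameStE e e' : e < size N -> e' < size N ->
  sameSt N e e' <-> st N (past N e) = st N (past N e').
Proof.
move=> eN e'N; split=> [S|E x].
  apply: st_inj => j; have [h _] := S (Tagged (@lstate _ _ _ A) (st N (past N e) j)).
  have [|b [/(inM_mk _ e'N) bE lb]] := h.
    exists (mk N (past N e) j); rewrite condlab_mk; split=> //.
    by apply/inM_mk => //; rewrite /mk mkn2.
  have bj := condlab_tag lb; move: lb; rewrite bE -bj /= => ->.
  by rewrite condlab_mk.
split=> -[b [/inM_mk bE lb]].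
  exists (mk N (past N e') b.2); split; first by apply/inM_mk => //; rewrite /mk mkn2.
  by rewrite condlab_mk -E -condlab_mk -bE.
exists (mk N (past N e) b.2); split; first by apply/inM_mk => //; rewrite /mk mkn2.
by rewrite condlab_mk E -condlab_mk -bE.
Qed.

Lemma sameipE e e' : e < size N -> e' < size N ->
  sameip N i e e' <-> mk N (past N e) i = mk N (past N e') i.
Proof.
move=> eN e'N; split=> [S|E b bi].
  have [h _] := S (mk N (past N e) i) (mkn2 _ _ _ _).
  have := h; rewrite !inM_mk //= /mk !mkn2; exact.
by rewrite !inM_mk // bi E.
Qed.

Lemma conflictE k e : confl N (inr k) (inr e) <-> conflict N k e.
Proof.
split=> [[z [k' [e' [ne [[k'N zk'] [[e'N ze'] [kk' ee']]]]]]]|[z [k' [e' [ne zk' ze' /pastP[k'N kk'] /pastP[e'N ee']]]]]].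
  by exists z, k', e'; split=> //; apply/pastP.
by exists z, k', e'; do !split.
Qed.

Lemma concurrentE k e : k < size N -> e < size N ->
  concurrent N (inr k) (inr e) <-> [/\ ~~ past N e k, ~~ past N k e & ~ conflict N k e].
Proof.
move=> kN eN; rewrite /concurrent conflictE; split=> [[h1 [h2 h3]]|[h1 h2 h3]]; split=> //.
- by apply/negP=> /pastP[].
- by apply/negP=> /pastP[].
- by move=> h; case/negP: h1; apply/pastP.
- by split=> // h; case/negP: h2; apply/pastP.
Qed.

End Occ.

Section Extension.
Variables (N X : net A) (oN : occurrence_net N) (oNX : occurrence_net (N ++ X)).

Lemma inM_cat e b : e < size N -> inM (N ++ X) e b <-> inM N e b.
Proof. by move=> eN; rewrite !inM_mark past_cat // mark_cat // => k /past_size. Qed.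

Lemma st_past_cat e : e < size N -> st (N ++ X) (past (N ++ X) e) = st N (past N e).
Proof. by move=> eN; rewrite past_cat // st_cat // => k /past_size. Qed.

Lemma mk_past_cat e j : e < size N -> mk (N ++ X) (past (N ++ X) e) j = mk N (past N e) j.
Proof. by move=> eN; rewrite past_cat // mk_cat // => k /past_size. Qed.

Lemma sameSt_cat e e' : e < size N -> e' < size N -> sameSt (N ++ X) e e' <-> sameSt N e e'.
Proof.
by move=> eN e'N; rewrite !sameStE ?st_past_cat ?(ltn_size_cat X).
Qed.

Lemma sameip_cat e e' : e < size N -> e' < size N -> sameip (N ++ X) i e e' <-> sameip N i e e'.
Proof. by move=> eN e'N; rewrite !sameipE ?mk_past_cat ?(ltn_size_cat X). Qed.

Lemma nlt_cat e e' : e < size N -> nlt (N ++ X) (inr e') (inr e) <-> nlt N (inr e') (inr e).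
Proof. by move=> eN; rewrite !nlt_past // past_cat. Qed.

Lemma nlt_cond_cat b b' : cond_in N b ->
  nlt (N ++ X) (inl b') (inl b) <-> nlt N (inl b') (inl b).
Proof.
rewrite !nlt_condE => bN; split=> -[g [k [bg gj b'k kg]]]; exists g, k;
  have gN : g < size N by move: bN; rewrite /cond_in bg.
- have : past (N ++ X) g k by apply/pastP; split=> //; apply: evpre_lt b'k.
  rewrite past_cat // => /pastP[kN kg'].
  by rewrite partb_cat // in gj; rewrite evpre_cat // in b'k.
- have : past N g k by apply/pastP; split=> //; apply: evpre_lt b'k.
  rewrite -(past_cat oN oNX) // => /pastP[_ kg'].
  by rewrite partb_cat // evpre_cat //; apply: evpre_lt b'k.
Qed.

Lemma llt_cat e e' : e < size N -> llt (N ++ X) e' e <-> llt N e' e.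
Proof.
move=> eN; rewrite /llt nlt_cat //; split=> -[lt h]; split=> // b b' b1 b2 b3 b4;
  have e'N : e' < size N by apply: ltn_trans (nlt_index oN lt) eN.
- have bN : cond_in N b by case: b1 => /isCond_in.
  by apply/(nlt_cond_cat b' bN)/h; rewrite inM_cat.
- move: b1 b2 b3 b4; rewrite !inM_cat // => b1 b2 b3 b4.
  by apply/nlt_cond_cat; [case: b1 => /isCond_in | apply: h].
Qed.

Lemma conflict_cat k e : k < size N -> e < size N ->
  conflict (N ++ X) k e <-> conflict N k e.
Proof.
move=> kN eN; split=> -[z [k' [e' [ne zk' ze']]]].
  rewrite !past_cat // => kk' ee'; exists z, k', e'; split=> //.
    by rewrite evpre_cat ?(past_size kk') in zk'.
  by rewrite evpre_cat ?(past_size ee') in ze'.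
move=> kk' ee'; exists z, k', e'.
by rewrite !past_cat // !evpre_cat ?(past_size kk') ?(past_size ee').
Qed.

Lemma concurrent_cat k e : k < size N -> e < size N ->
  concurrent (N ++ X) (inr k) (inr e) <-> concurrent N (inr k) (inr e).
Proof.
move=> kN eN; rewrite !concurrentE ?(ltn_size_cat X) // !past_cat //.
by split=> -[h1 h2 h3]; split=> // /(conflict_cat kN eN).
Qed.

Lemma Con_cat (co co' : seq (nat * nat)) e k : e < size N -> k < size N ->
  (k \in map fst co') = (k \in map fst co) -> Con (N ++ X) i co' e k <-> Con N i co e k.
Proof.
move=> eN kN E; rewrite /Con /iev partb_cat // E concurrent_cat //.
by rewrite kN (ltn_size_cat X kN).
Qed.

Lemma cutoff_cat e : e < size N -> cutoff (N ++ X) i e <-> cutoff N i e.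
Proof.
move=> eN; rewrite /cutoff /iev partb_cat //.
split=> -[ei [c [ce [ci S]]]]; split=> //; exists c; have cN := ltn_trans ce eN;
  by move: ci S; rewrite partb_cat // sameSt_cat.
Qed.

(** The witness persists: [<<], St and ip of old events are unaffected, and the hypothesis on
    non-cut-off i-events prevents [Con] from gaining a new event. *)
Lemma cand_cat (co co' : seq (nat * nat)) e : e < size N ->
  (forall k, k < size N -> (k \in map fst co') = (k \in map fst co)) ->
  (forall k, iev (N ++ X) i k -> k \notin map fst co' -> k < size N) ->
  cand N i co e -> cand (N ++ X) i co' e.
Proof.
move=> eN E new [ei [e' [lt [S [ip sub]]]]].
have e'N : e' < size N by case: lt => /(nlt_index oN) e'e _; apply: ltn_trans eN.
split; first by rewrite /iev partb_cat.
exists e'; split; first exact/llt_cat.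
split; first exact/sameSt_cat.
split; first exact/sameip_cat.
move=> k hk; have kN : k < size N by case: hk => _ [ki [kc _]]; apply: new.
by apply/(Con_cat e'N kN (E _ kN))/sub/(Con_cat eN kN (E _ kN)).
Qed.

End Extension.

(** [inv_past] says that cut-offs and candidates are causally maximal; [inv_noncut] that no i-event
    outside [co] repeats the global state of an earlier i-event. *)
Record alg_inv (N : net A) (co : seq (nat * nat)) (coc : seq nat) : Prop := AlgInv {
  inv_occ : occurrence_net N;
  inv_co : forall e c, (e, c) \in co ->
    [/\ c < e, e < size N, iev N i e, iev N i c & sameSt N e c];
  inv_coc : forall e, e \in coc -> e < size N /\ cand N i co e;
  inv_past : forall e k, e \in map fst co ++ coc -> past N k e -> k < size N -> k = e;
  inv_noncut : forall k, k < size N -> iev N i k -> k \notin map fst co -> ~ cutoff N i k }.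

Lemma alg_inv_init : alg_inv ([::] : net A) [::] [::].
Proof. by split=> //; apply: occurrence_nil. Qed.

Lemma alg_step_cat N co coc N' co' coc' :
  alg_step i (N, co, coc) (N', co', coc') -> exists x, N' = N ++ [:: x].
Proof. by case=> t [M [_ [_ [-> _]]]]; exists (t, M); rewrite cats1. Qed.

(** Only a new non-cut-off i-event can enter [Con] of an old event. The first two branches add none,
    so candidates persist by [cand_cat]; the third filters [coc]. *)
Lemma alg_inv_step N co coc N' co' coc' : alg_inv N co coc ->
  alg_step i (N, co, coc) (N', co', coc') -> alg_inv N' co' coc'.
Proof.
move=> [oN Ico Icoc Ipast Inon] [t [M [px [pf [EN' /= step]]]]].
have oN' : occurrence_net N' by rewrite EN'; apply: occurrence_rcons.
rewrite /past_free -EN' in pf; have EX : N' = N ++ [:: (t, M)] by rewrite cats1.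
have sz : size N' = (size N).+1 by rewrite EX size_cat addn1.
have newN : size N < size N' by rewrite sz.
have lt k : k < size N' -> k < size N \/ k = size N.
  by rewrite sz ltnS leq_eqVlt => /orP[/eqP|]; auto.
have coN e : e \in map fst co -> e < size N.
  by case/mapP=> -[e1 c1] /Ico[_ h _ _ _] ->.
have pN e : e \in map fst co ++ coc -> e < size N.
  by rewrite mem_cat => /orP[/coN//|/Icoc[]].
have Ico' e c : (e, c) \in co -> [/\ c < e, e < size N', iev N' i e, iev N' i c & sameSt N' e c].
  move=> /Ico[ce eN ei ci S]; have cN := ltn_trans ce eN.
  have eN' : e < size N' by rewrite sz ltnW.
  by split=> //; rewrite ?/iev EX ?partb_cat //; apply/sameSt_cat => //; rewrite -EX.
have pc k : k < size N -> past N' k = past N k.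
  by move=> kN; rewrite EX past_cat // -EX.
(* [past_free] keeps every old cut-off and candidate out of the past of the new event. *)
have Ipast' e k : e \in map fst co ++ coc -> past N' k e -> k < size N' -> k = e.
  move=> eco ke /lt[kN|kE].
    by apply: (Ipast _ _ eco _ kN); rewrite -(pc _ kN).
  case: (eqVneq k e) => // /eqP ne; case: (pf _ eco); apply/nlt_past => //.
  by rewrite -kE; split=> // ek; apply: ne.
have Inew k : past N' k (size N) -> k < size N' -> k = size N.
  by move=> /(past_leq oN') h1; rewrite sz => h2; apply/eqP; rewrite eqn_leq h1 -ltnS h2.
have Inon' k : k < size N -> iev N' i k -> k \notin map fst co -> ~ cutoff N' i k.
  move=> kN; rewrite /iev EX partb_cat // => ki kc; rewrite cutoff_cat // -?EX //.
  exact: Inon.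
have Icoc' cc e : (forall k, k < size N -> (k \in map fst cc) = (k \in map fst co)) ->
    (forall k, iev N' i k -> k \notin map fst cc -> k < size N) ->
    e \in coc -> cand N' i cc e.
  move=> h1 h2 /Icoc[eN ce]; rewrite EX; apply: (cand_cat _ _ _ _ _ ce) => //; by rewrite -EX.
case: step => [[c [ce [ei [ci [S [-> ->]]]]]]|[nc [cd [-> ->]]]|[nc [_ [-> ->]]]].
- split=> //.
  + move=> e c'; rewrite mem_rcons inE => /orP[/eqP[-> ->]|]; by [split | apply: Ico'].
  + move=> e ecoc; have [eN _] := Icoc _ ecoc; split; first by rewrite sz ltnW.
    apply: Icoc' => // k; rewrite map_rcons mem_rcons inE /=.
      by move=> kN; rewrite ltn_eqF.
    move=> /partb_lt/lt[//|->]; by rewrite eqxx.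
  + move=> e k; rewrite map_rcons cat_rcons mem_cat inE /=.
    case: (eqVneq e (size N)) => [-> _|_ /=]; first exact: Inew.
    by rewrite -mem_cat; apply: Ipast'.
  + move=> k /lt[kN|->] ki; rewrite map_rcons mem_rcons inE negb_or /=.
      by move=> /andP[_]; apply: Inon'.
    by rewrite eqxx.
- have nei : ~~ iev N' i (size N) by case: cd.
  split=> //.
  + move=> e; rewrite mem_rcons inE => /orP[/eqP->//|ecoc].
    have [eN _] := Icoc _ ecoc; split; first by rewrite sz ltnW.
    apply: Icoc' => // k ki _; case: (lt _ (partb_lt ki)) => // E.
    by rewrite E (negbTE nei) in ki.
  + move=> e k; rewrite mem_cat mem_rcons inE orbCA -mem_cat.
    by case: (eqVneq e (size N)) => [-> _|_ /=]; [apply: Inew | apply: Ipast'].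
  + move=> k /lt[kN|->] ki; first exact: Inon'.
    by rewrite ki in nei.
- split=> //.
  + move=> e; rewrite mem_filter => /andP[/asboolP ce /Icoc[eN _]].
    by rewrite sz ltnW.
  + move=> e k eco; apply: Ipast'.
    by move: eco; rewrite !mem_cat mem_filter => /orP[->//|/andP[_ ->]]; rewrite orbT.
  + move=> k /lt[kN|->] ki; first exact: Inon'.
    by [].
Qed.

Lemma alg_inv_reach N co coc :
  clos_refl_trans (astate A) (alg_step i) (ainit A) (N, co, coc) -> alg_inv N co coc.
Proof.
move=> h; have {}h := clos_rt_rtn1 _ _ _ _ h.
suff : alg_inv (N, co, coc).1.1 (N, co, coc).1.2 (N, co, coc).2 by [].
elim: {N co coc}(N, co, coc) / h => [|[[N1 co1] coc1] [[N2 co2] coc2] step _ IH]; first exact: alg_inv_init.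
exact: alg_inv_step IH step.
Qed.

End Invariant.

(** * Weights, sizes and visible words of configurations *)

Section Weights.
Variables (Sig : finType) (R : realType) (n : nat) (A : 'I_n -> wlts Sig R) (i : 'I_n).
Implicit Types (N : net A) (C D : pred nat) (b q : cond n) (t : gtrans A).

Definition cwt N C : R := (\sum_(k <- iota 0 (size N) | C k) ewt N k)%R.
Definition ncf N C : nat := count C (iota 0 (size N)).
Definition hwt (h : seq (gtrans A)) : R := (\sum_(t <- h) gweight t)%R.
Definition iproj (h : seq (gtrans A)) : seq Sig :=
  [seq a <- map fst h | a \in calph (A i)].

Lemma hwt_cat h1 h2 : hwt (h1 ++ h2) = (hwt h1 + hwt h2)%R.
Proof. exact: big_cat. Qed.

Lemma hwt_cons t h : hwt (t :: h) = (gweight t + hwt h)%R.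
Proof. exact: big_cons. Qed.

Lemma iproj_cat h1 h2 : iproj (h1 ++ h2) = iproj h1 ++ iproj h2.
Proof. by rewrite /iproj map_cat filter_cat. Qed.

Lemma hwt_labs N s : hwt (labs N s) = (\sum_(k <- s) ewt N k)%R.
Proof.
elim: s => [|k s IH]; first by rewrite /hwt !big_nil.
rewrite big_cons -IH /labs /= /ewt; case: (evlab N k) => [t|] /=; last by rewrite add0r.
by rewrite hwt_cons.
Qed.

Lemma hwt_diff N C C' : (forall k, C k -> C' k) ->
  hwt (labs N (diff N C C')) = (cwt N C' - cwt N C)%R.
Proof.
move=> CC'; rewrite hwt_labs big_filter /cwt [X in (X - _)%R](bigID C) /=.
rewrite [X in (X + _ - _)%R](_ : _ = \sum_(k <- iota 0 (size N) | C k) ewt N k)%R.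
  by rewrite addrAC subrr add0r.
by apply: eq_bigl => k; apply: andb_idl => /CC'.
Qed.

Lemma size_diff N C C' : (forall k, C k -> C' k) ->
  size (diff N C C') + ncf N C = ncf N C'.
Proof.
move=> CC'; rewrite size_filter /ncf; elim: (iota 0 (size N)) => //= x s IH.
by have := CC' x; case: (C x) => [->|_] //=; case: (C' x) => /=; lia.
Qed.

Lemma size_labs N s : size (labs N s) <= size s.
Proof. by rewrite size_pmap count_size. Qed.

Lemma ncf_sub N C C' : (forall k, C k -> C' k) -> ncf N C <= ncf N C'.
Proof. by move=> /size_diff <-; apply: leq_addl. Qed.

Lemma ncf_lt N C C' e : conf N C' -> (forall k, C k -> C' k) -> C' e -> ~~ C e ->
  ncf N C < ncf N C'.
Proof.
move=> cC' CC' C'e nCe; rewrite -(size_diff N CC').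
have : e \in diff N C C' by rewrite mem_diff // C'e.
by case: (diff N C C') => // *; rewrite /= addSn ltnS leq_addl.
Qed.

Lemma valid_calph t : gvalid t -> (t.1 \in calph (A i)) = (t.2 i != None).
Proof. by case=> _ /(_ i); case: (_ \in _) => [[p [-> _]]|->]. Qed.

Lemma iproj_labs N s : occurrence_net N ->
  iproj (labs N s) = map fst (labs N [seq k <- s | iev N i k]).
Proof.
move=> oN; elim: s => //= k s IH; rewrite /labs /= -/(labs N s).
case E: (evlab N k) => [t|] /=.
  rewrite [LHS]/iproj /= (valid_calph (occ_valid oN E)) /iev (partbE _ E).
  by case: ifP => _; rewrite -/(iproj _) IH //= E.
by rewrite /iev /partb E IH.
Qed.

Lemma iproj_diff0 N C C' : occurrence_net N -> conf N C' ->
  (forall g, C' g -> iev N i g -> C g) -> iproj (labs N (diff N C C')) = [::].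
Proof.
move=> oN cC' h; rewrite iproj_labs // (_ : [seq k <- _ | _] = [::]) //.
apply/eqP; rewrite -(negbK (_ == _)) -has_filter; apply/hasPn => k.
rewrite mem_diff // => /andP[C'k nCk]; apply/negP => /(h _ C'k).
exact/negP.
Qed.

Lemma cwt_addev N C k : k < size N -> ~~ C k -> cwt N (addev C k) = (cwt N C + ewt N k)%R.
Proof.
move=> kN nCk; rewrite /cwt (bigID C) /=; congr (_ + _)%R.
  by apply: eq_bigl => x; rewrite /addev; case: (C x); rewrite ?andbF.
rewrite (eq_bigl (fun x => x == k)); last first.
  by move=> x; rewrite /addev; case: eqP => [->|]; rewrite ?nCk ?orbT ?orbF ?andbN.
by rewrite -big_filter (filter_pred1_uniq (iota_uniq _ _)) ?mem_iota // big_seq1.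
Qed.

Lemma ncf_addev N C k : k < size N -> ~~ C k -> ncf N (addev C k) = (ncf N C).+1.
Proof.
move=> kN nCk; have sub x : C x -> addev C k x by rewrite /addev => ->.
rewrite -(size_diff N sub).
rewrite -[RHS]add1n; congr (_ + _).
rewrite size_filter (eq_count (a2 := pred1 k)); first by rewrite count_uniq_mem ?iota_uniq // mem_iota kN.
by move=> x; rewrite /addev /=; case: eqP => [->|]; rewrite ?nCk ?orbT ?orbF ?andbN.
Qed.

Lemma gweight_ge0 t : (forall j, wlts_wf (A j)) -> gvalid t -> (0 <= gweight t)%R.
Proof.
move=> wf [_ vt]; apply: sumr_ge0 => j _; have := vt j; have [_ w0] := wf j.
by case: ifP => _; [case=> p [-> [/w0]] | move->].
Qed.

Lemma ewt_ge0 N k : (forall j, wlts_wf (A j)) -> occurrence_net N -> (0 <= ewt N k)%R.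
Proof.
move=> wf oN; rewrite /ewt; case E: (evlab N k) => [t|] //.
by apply: gweight_ge0 => //; apply: occ_valid oN _ _ E.
Qed.

Lemma cwt_sub N C C' : (forall j, wlts_wf (A j)) -> occurrence_net N ->
  (forall k, C k -> C' k) -> (cwt N C <= cwt N C')%R.
Proof.
move=> wf oN /(hwt_diff N) E; rewrite -subr_ge0 -E hwt_labs.
by apply: sumr_ge0 => k _; apply: ewt_ge0.
Qed.

End Weights.

(** * Soundness and completeness of the folding *)

Section Fold.
Variables (Sig : finType) (R : realType) (n : nat) (A : 'I_n -> wlts Sig R) (i : 'I_n).
Variables (N : net A) (co : seq (nat * nat)) (coc : seq nat).
Hypothesis inv : alg_inv i N co coc.
Implicit Types (C D : pred nat) (b q : cond n) (t : gtrans A).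

Let oN : occurrence_net N := inv_occ inv.

(** For a condition [q], the least configuration whose cut contains it. *)
Definition basec q : pred nat := if q.1 is Some e then past N e else pred0.

Lemma st0 : st N pred0 = ginit A.
Proof. by rewrite /st; elim: (size N). Qed.

(** The cut of [[k]] truncated below [k] contains [b], so the producer of [b] is the last event of
    its component there; [part_total] puts [g] below it. *)
Lemma pre_last k b g : b \in evpre N k -> past N k g -> g <> k -> partb N g b.2 ->
  exists2 a, b.1 = Some a & past N a g.
Proof.
move=> bk kg gk gb; have kN := evpre_lt bk; have cC := past_conf oN kN.
have lt : g < k by rewrite ltn_neqAle (past_leq oN kg) andbT; apply/eqP.
have ch := conf_leq oN k cC; have := conf_leq oN k.+1 cC.
rewrite addev_leq ?past_refl // => ch1.
have nk : ~~ (past N k k && (k < k)) by rewrite ltnn andbF.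
have := pre_mk oN ch ch1 nk (pre_part oN bk).
have Cg : past N k g && (g < k) by rewrite kg.
have [a aE ga] := @mkn_max _ _ _ _ N (fun x => past N k x && (x < k)) (size N) b.2 g Cg gb (partb_lt gb).
have [/andP[ka _] ab _] : [/\ past N k a && (a < k), partb N a b.2 & a < size N].
  by apply: (@mkn_some _ _ _ _ N (fun x => past N k x && (x < k)) (size N) b.2 a); rewrite aE.
rewrite /mk aE => ak; have bE := occ_pre_inj oN bk ak erefl.
exists a; first by rewrite bE.
exact: (part_total oN cC kg ka gb ab ga).
Qed.

(** The preset of [k] has a single i-condition, so [ohead] picks [b]; an initial [b] has an empty
    base of weight zero. *)
Lemma ciwE k b : b \in evpre N k -> b.2 = i ->
  ciw i N k = (cwt N (past N k) - cwt N (basec b))%R.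
Proof.
move=> bk bi; rewrite /ciw.
have -> : ohead [seq b <- evpre N k | b.2 == i] = Some b.
  have : b \in [seq b <- evpre N k | b.2 == i] by rewrite mem_filter bi eqxx.
  case E: [seq _ <- _ | _] => [|c s] // _ /=; congr Some.
  have : c \in [seq b <- evpre N k | b.2 == i] by rewrite E mem_head.
  by rewrite mem_filter => /andP[/eqP ci ck]; apply: (occ_pre_inj oN ck bk); rewrite ci.
case: b {bk bi} => [[a|] j] //.
by rewrite [X in (_ - X)%R](_ : _ = 0)%R ?subr0 // /cwt big_pred0_eq.
Qed.

Section Edge.
Variables (k : nat) (b : cond n).
Hypotheses (bk : b \in evpre N k) (bi : b.2 = i).

Lemma edge_iev : iev N i k. Proof. by rewrite /iev -bi; apply: pre_part. Qed.

Lemma edge_conf : conf N (basec b).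
Proof.
rewrite /basec; case E: b.1 => [a|]; last exact: conf0.
apply: past_conf => //; have ak : (Some a, b.2) \in evpre N k by rewrite -E; case: (b) bk.
exact: past_size (past_pre oN ak).
Qed.

Lemma edge_sub g : basec b g -> past N k g.
Proof.
rewrite /basec; case E: b.1 => [a|] //.
have ak : (Some a, b.2) \in evpre N k by rewrite -E; case: (b) bk.
exact/past_trans/(past_pre oN ak).
Qed.

(** Any other i-event of [[k]] lies below the producer of [b] by [pre_last], that is, in the
    base. *)
Lemma edge_new g : past N k g -> iev N i g -> ~~ basec b g -> g = k.
Proof.
move=> kg gi ng; apply: contrapT => gk.
have gb : partb N g b.2 by rewrite bi.
by have [a aE ag] := pre_last bk kg gk gb; move: ng; rewrite /basec aE ag.
Qed.

Lemma edge_fresh : ~~ basec b k.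
Proof.
rewrite /basec; case E: b.1 => [a|] //.
have ak : (Some a, b.2) \in evpre N k by rewrite -E; case: (b) bk.
by apply/negP => /(past_leq oN); rewrite leqNgt (occ_index oN ak).
Qed.

Lemma edge_iproj t : evlab N k = Some t -> iproj i (labs N (diff N (basec b) (past N k))) = [:: t.1].
Proof.
move=> lk; have kN := evpre_lt bk; rewrite iproj_labs //.
suff -> : [seq x <- diff N (basec b) (past N k) | iev N i x] = [:: k] by rewrite /labs /= lk.
apply: perm_small_eq => //; apply: uniq_perm => //; first by do 2 apply: filter_uniq; exact: iota_uniq.
move=> g; rewrite mem_filter mem_diff ?inE; last exact: past_conf.
apply/andP/eqP => [[gi /andP[kg ng]]|->]; first exact: edge_new.
by rewrite edge_iev edge_fresh past_refl.
Qed.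

End Edge.

Lemma cequiv_base e c : (e, c) \in co -> cequiv i N co (Some e, i) (Some c, i).
Proof.
move=> ec; have [ce eN ei ci _] := inv_co inv ec; have cN := ltn_trans ce eN.
apply: rst_step; exists e, c; do 4!split=> //.
  by apply/inM_mk => //=; rewrite (mk_past_self oN).
by apply/inM_mk => //=; rewrite (mk_past_self oN).
Qed.

(** A generating pair relates the outputs of a cut-off and of its companion, whose bases are the two
    pasts with the same St. *)
Lemma cequiv_st q q' : cequiv i N co q q' -> st N (basec q) = st N (basec q').
Proof.
elim=> {q q'} [q q'|//|q q' _ ->//|x y z _ -> _ ->//].
case=> e [c [ec [qi [q'i [mq mq']]]]].
have [ce eN ei ci S] := inv_co inv ec; have cN := ltn_trans ce eN.
move: mq mq' => /(inM_mk oN _ eN) -> /(inM_mk oN _ cN) ->.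
rewrite qi q'i !(mk_past_self oN) //=.
by apply/sameStE.
Qed.

(** Each edge is realised from the base of its input to [[k]]. By [cequiv_st] all members of a class
    have bases with the same state, so the pieces concatenate. *)
Lemma fold_sound q fh : run (fstep i N co) q fh -> exists h,
  [/\ run (@gstep _ _ _ A) (st N (basec q)) h,
      iproj i h = map (fun kt : nat * gtrans A => kt.2.1) fh &
      hwt h = (\sum_(kt <- fh) ciw i N kt.1)%R].
Proof.
elim: fh q => [|[k t] fh IH] q /=.
  by exists [::]; split=> //; rewrite /hwt !big_nil.
case=> q' [[kN [ki [lk [[b [bk [bi qb]]] q'k]]]] /IH[h [rh ph wh]]].
have [r1 e1] := conf_run oN (edge_conf bk) (past_conf oN kN) (fun g => @edge_sub k b bk g).
exists (labs N (diff N (basec b) (past N k)) ++ h); split.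
- apply/run_cat; rewrite (cequiv_st qb) e1; split=> //.
  by rewrite -[past N k]/(basec (Some k, i)) -(cequiv_st q'k).
- by rewrite iproj_cat (edge_iproj bk bi lk) ph.
- rewrite hwt_cat big_cons -wh (ciwE bk bi) hwt_diff //.
  by move=> g; apply: edge_sub.
Qed.

Hypothesis wf : forall j, wlts_wf (A j).
Hypothesis fin : alg_final (N, co, coc).

(** The representatives from which completeness works: the output of every i-event is equivalent to
    one ([companion]), and their bases contain no cut-off or candidate ([base_clean]). *)
Definition baseq q : Prop := q = (None, i) \/
  exists k, [/\ q = (Some k, i), k < size N, iev N i k & k \notin map fst co].

Lemma base_conf q : baseq q -> conf N (basec q).
Proof.
case=> [->|[k [-> kN _ _]]]; first exact: conf0.
exact: past_conf.
Qed.

(** A cut-off or candidate in [[k]] would be [k] itself by maximality, but [k] is an i-event outside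
    [co]. *)
Lemma base_clean q e : baseq q -> e \in map fst co ++ coc -> ~~ basec q e.
Proof.
case=> [->//|[k [-> kN ki kco]]] eco; apply/negP => ke.
have kE := inv_past inv eco ke kN; move: eco; rewrite -kE mem_cat (negbTE kco) /=.
by case/(inv_coc inv) => _ []; rewrite ki.
Qed.

(** [C] has the same i-events as the base of [q], so its i-condition is still [q]. *)
Lemma base_mk q C : baseq q -> (forall g, basec q g -> C g) ->
  (forall g, C g -> iev N i g -> basec q g) -> mk N C i = q.
Proof.
move=> bq qC Cq; case: bq qC Cq => [->|[k [-> kN ki kco]]] qC Cq.
  case E: (mk N C i) => [o j]; have := mkn2 N C (size N) i; rewrite [mkn _ _ _ _]E /= => ->.
  case: o E => [k|//] E.
  have [Ck kj _] : [/\ C k, partb N k i & k < size N].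
    by apply: (@mkn_some _ _ _ _ N C (size N) i k); rewrite [mkn _ _ _ _]E.
  by have := Cq _ Ck kj.
have Ck : C k by apply: qC; apply: past_refl.
have [k' E kk'] := @mkn_max _ _ _ _ N C (size N) i k Ck ki kN.
have [Ck' ki' _] : [/\ C k', partb N k' i & k' < size N].
  by apply: (@mkn_some _ _ _ _ N C (size N) i k'); rewrite E.
rewrite /mk E; congr (Some _, _); apply/eqP; rewrite eqn_leq kk' andbT.
exact: (past_leq oN (Cq _ Ck' ki')).
Qed.

(* If [e] is concurrent with [k], the condition [e' << e] forces every common
   predecessor of [k] and [e] below [e']: a maximal one outside [[e']] would have
   an output in M(e) \ M(e') leading to [k], hence [e' < k]. *)
Lemma swap_candidate q C e : baseq q -> conf N C -> (forall g, basec q g -> C g) ->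
  (forall g, C g -> iev N i g -> basec q g) -> e \in coc -> C e ->
  exists e', [/\ past N e e', e' < e, st N (past N e) = st N (past N e') &
                 forall f, basec q f -> past N e f -> past N e' f].
Proof.
move=> bq cC qC Cq ecoc Ce.
have [eN [nei [e' [lt [S [ip sub]]]]]] := inv_coc inv ecoc.
have ee' := lt.1; have e'e := nlt_index oN ee'; have e'N := ltn_trans e'e eN.
exists e'; split=> //; first by case/(nlt_past oN): ee'.
  exact/sameStE.
case: bq qC Cq => [->//|[k [-> kN ki kco]]] qC Cq f /= kf ef.
have Ck : C k by apply: qC; apply: past_refl.
have nke : ~~ past N k e.
  have bq : baseq (Some k, i) by right; exists k.
  by apply: (base_clean bq); rewrite mem_cat ecoc orbT.
(* If [k] is below [e], then ip(e) is the output of [k], and ip(e') = ip(e) puts [k], hence its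
   whole past, below [e']. *)
have [ek|nek] := boolP (past N e k).
  suff e'k : past N e' k by apply: past_trans e'k kf.
  have mE : mk N (past N e) i = (Some k, i).
    apply: (@base_mk (Some k, i)); first by right; exists k.
      by move=> g; apply: past_trans.
    by move=> g /(conf_past oN cC Ce); apply: Cq.
  move/(sameipE i oN eN e'N): ip; rewrite mE => /esym mE'.
  have [] // : [/\ past N e' k, partb N k i & k < size N].
  by apply: (@mkn_some _ _ _ _ N (past N e') (size N) i k); rewrite [mkn _ _ _ _]mE'.
have ncf_ke : ~ conflict N k e.
  case=> z [k1 [e1 [ne zk ze kk1 ee1]]]; have [_ _ fC] := cC; apply: ne.
  by apply: fC zk ze; [exact: (conf_past oN cC Ck kk1) | exact: (conf_past oN cC Ce ee1)].
have [_ [_ [_ /(concurrentE kN e'N)[nk1 nk2 _]]]] : Con N i co e' k.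
  by apply: sub; do 3!split=> //; apply/concurrentE.
apply: contrapT => ne'f; case/negP: nk2.
have [g [[kg eg ne'g] gmax]] : exists g, [/\ past N k g, past N e g & ~ past N e' g] /\
    forall g', g < g' -> ~ [/\ past N k g', past N e g' & ~ past N e' g'].
  have ex : exists g, `[< [/\ past N k g, past N e g & ~ past N e' g] >].
    by exists f; apply/asboolP.
  have ub g : `[< [/\ past N k g, past N e g & ~ past N e' g] >] -> g <= k.
    by move=> /asboolP[/(past_leq oN)].
  case: (ex_maxnP ex ub) => g /asboolP Pg gmax; exists g; split=> // g' gg' /asboolP /gmax.
  by rewrite leqNgt gg'.
case: (past_first kg) => [gk|[j [h [gj gh kh]]]]; first by rewrite gk (negbTE nek) in eg.
have gh' := occ_index oN gh.
have neh : ~ past N e h.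
  move=> eh; apply: (gmax _ gh'); split=> // e'h.
  by apply: ne'g; apply: past_pre_trans e'h gh.
(* Since [e'] is below [e], some [h'] in [[e]] consumes an output of [e']; that output is the
   condition of M(e') \ M(e) to which [<<] is applied. *)
have [j' [h' [e'j e'h' h'e]]] := nlt_event_first ee'.
have eh' : past N e h' by apply/pastP; split=> //; apply: evpre_lt e'h'.
have : nlt N (inl (Some e', j')) (inl (Some g, j)).
  apply: lt.2.
  - apply/inM_mark; split=> //; split=> // -[x [ex gx]]; apply: ncf_ke.
    by exists (Some g, j), h, x; split=> // hx; apply: neh; rewrite hx.
  - by case/inM_mark=> _ [].
  - apply/inM_mark; split=> //; split; first exact: past_refl.
    case=> x [/(past_leq oN) xe' /(occ_index oN)]; by rewrite ltnNge xe'.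
  - by case/inM_mark=> _ [_ []]; exists h'.
case/nlt_condE => g1 [x [[<-] _ e'x xg]].
have gx : past N g x by apply/pastP; split=> //; apply: evpre_lt e'x.
exact: past_trans kg (past_pre_trans oN gx e'x).
Qed.

(** If no event of [N] had label [t] and the current conditions as preset, [(t, M)] would be a
    possible extension whose past lies in [C], hence avoids [co] and [coc], contradicting
    [alg_final]. *)
Lemma fire_event C t (s' : gstate A) : conf N C ->
  (forall e, e \in map fst co ++ coc -> ~~ C e) -> gstep (st N C) t s' ->
  exists k, [/\ evlab N k = Some t, ~~ C k, conf N (addev C k) & s' = st N (addev C k)].
Proof.
move=> cC clean gs; have [vt sE] := gs.
pose M := [seq mk N C j | j <- enum 'I_n & t.2 j != None].
have MC b : b \in M -> b = mk N C b.2 /\ t.2 b.2 != None.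
  by case/mapP=> j; rewrite mem_filter => /andP[tj _] ->; rewrite /mk mkn2.
have Mmk b : b \in M -> mark N C b by move=> /MC[-> _]; apply: mark_mk.
suff [k [kN [lk pk]]] : exists k, k < size N /\ evlab N k = Some t /\ evpre N k =i M.
  have mkk b : b \in evpre N k -> mark N C b by rewrite pk; apply: Mmk.
  have nCk := mark_notin oN kN mkk; have cCk := conf_addev cC kN mkk.
  exists k; split=> //; rewrite (gstep_fire gs).
  by rewrite -(gstep_fire (st_addev oN cC cCk nCk lk)).
apply: contrapT => nex; apply: fin; exists t, M.
have [m rm mE] := conf_reachable oN cC.
have px : pext N t M.
  split=> //; split; first by exists m; split=> // b /Mmk/mE.
  split=> //; suff -> : map (condlab N) M = map Some (pre_t t) by [].
  rewrite /M /pre_t; elim: (enum 'I_n) => //= j s IH.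
  have := sE j; case: (t.2 j) => [p [sj _]|_] /=; last exact: IH.
  by rewrite IH condlab_mk sj.
split=> // e eco; have oN' := occurrence_rcons oN px.
case/nlt_event_last => a [j [am ea]].
have aM : (Some a, j) \in M by move: am; rewrite /evpre -cats1 onth_cat ltnn subnn.
have [_ [/= Ca _]] := Mmk _ aM.
case/negP: (clean _ eco); apply: (conf_past oN cC Ca).
have aN : a < size N by case: cC => sC _ _; apply: sC.
rewrite -(past_cat (X := [:: (t, M)]) oN _ aN) cats1 //.
apply/pastP; split=> //; case: ea => [[->]|/nlt_event_first[? [? [/partb_lt]]]] //.
by rewrite size_rcons ltnW.
Qed.

(** A companion may itself be a cut-off; indices decrease along companions, so following them ends
    at a non-cut-off event. *)
Lemma companion k : k < size N -> iev N i k ->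
  exists c, [/\ baseq (Some c, i), st N (past N c) = st N (past N k) &
                cequiv i N co (Some c, i) (Some k, i)].
Proof.
elim/ltn_ind: k => k IH kN ki.
have [kco|nco] := boolP (k \in map fst co); last first.
  exists k; split=> //; last exact: rst_refl.
  by right; exists k.
case/mapP: kco => -[k' c] kc /= kE; rewrite -kE in kc.
have [ck _ _ ci S] := inv_co inv kc; have cN := ltn_trans ck kN.
have [c' [bc' sc' ec']] := IH _ ck cN ci; exists c'; split=> //.
  by rewrite sc'; apply/esym/sameStE.
by apply: rst_trans ec' _; apply/rst_sym/cequiv_base.
Qed.

(** The events of [C] outside the base are fired but not yet charged to an edge, hence the term
    [cwt N C - cwt N (basec q)] in the bound. *)
Lemma fold_complete_conf q C rest : baseq q -> conf N C -> (forall g, basec q g -> C g) ->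
  (forall g, C g -> iev N i g -> basec q g) -> run (@gstep _ _ _ A) (st N C) rest ->
  exists fh, [/\ run (fstep i N co) q fh,
     map (fun kt : nat * gtrans A => kt.2.1) fh = iproj i rest &
     (\sum_(kt <- fh) ciw i N kt.1 <= cwt N C - cwt N (basec q) + hwt rest)%R].
Proof.
(* The measure, events of [C] outside the base plus remaining steps, drops at a swap and when an
   edge is completed. An event that is no i-event leaves it unchanged and is handled by the inner
   induction on [rest]. *)
have [m] := ubnP (ncf N C - ncf N (basec q) + size rest).
elim: m q C rest => // m IH q C rest; elim: rest C => [|t v IHv] C lt bq cC qC Cq rC.
  exists [::]; split=> //; rewrite /hwt !big_nil addr0 subr_ge0.
  exact: cwt_sub.
have szC := size_diff N qC.
have [[e [ecoc Ce]]|nococ] := pselect (exists e, e \in coc /\ C e).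
  have [e' [ee' e'e SE sw]] := swap_candidate bq cC qC Cq ecoc Ce.
  have eN : e < size N by case: cC => sC _ _; apply: sC.
  have e'N := ltn_trans e'e eN; have cB := base_conf bq.
  (* [D] and [D'] join the base with [[e]] and [[e']]. The new history restarts at the base, goes to
     [D'], then fires the events of [C] outside [D] and the remaining steps. *)
  pose D k := basec q k || past N e k; pose D' k := basec q k || past N e' k.
  have pe'e k : past N e' k -> past N e k by apply: past_trans.
  have D'D k : D' k -> D k by rewrite /D' /D => /orP[->//|/pe'e->]; rewrite orbT.
  have eC k : past N e k -> C k by apply: (conf_past oN).
  have DC k : D k -> C k by case/orP=> [/qC|/eC].
  have cD : conf N D by apply: (conf_unionl cC cB (past_conf oN eN)).
  have cD' : conf N D'.
    by apply: (conf_unionl cC cB (past_conf oN e'N)) => // k /pe'e/eC.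
  have qD' k : basec q k -> D' k by rewrite /D' => ->.
  (* From the common state of [[e]] and [[e']] both configurations are reached by firing the same
     events, since the base meets [[e]] and [[e']] in the same set. *)
  have sD : st N D = st N D'.
    have eD k : past N e k -> D k by rewrite /D orbC => ->.
    have eD' k : past N e' k -> D' k by rewrite /D' orbC => ->.
    have [_ <-] := conf_run oN (past_conf oN eN) cD eD.
    have [_ <-] := conf_run oN (past_conf oN e'N) cD' eD'.
    rewrite SE; congr (endst _ (labs N _)); apply: eq_filter => k; rewrite /D /D'.
    case qk: (basec q k) => /=; last by rewrite !andbN.
    congr negb; apply/idP/idP; [exact: sw | exact: pe'e].
  have [r1 e1] := conf_run oN cB cD' qD'; have [r2 e2] := conf_run oN cD cC DC.
  pose h := labs N (diff N (basec q) D') ++ labs N (diff N D C) ++ t :: v.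
  have rh : run (@gstep _ _ _ A) (st N (basec q)) h.
    by apply/run_cat; split=> //; rewrite e1 -sD; apply/run_cat; rewrite e2.
  have p1 : iproj i (labs N (diff N (basec q) D')) = [::].
    by apply: iproj_diff0 => // g /D'D/DC; apply: Cq.
  have p2 : iproj i (labs N (diff N D C)) = [::].
    by apply: iproj_diff0 => // g Cg gi; rewrite /D (Cq _ Cg gi).
  have s1 := size_diff N qD'; have s2 := size_diff N DC.
  (* [e] belongs to [D] only: it is outside the base by [base_clean], and its index exceeds that of
     [e']. *)
  have s3 : ncf N D' < ncf N D.
    apply: (@ncf_lt _ _ _ _ _ _ _ e cD D'D); first by rewrite /D past_refl ?orbT.
    rewrite /D' negb_or (base_clean bq) ?mem_cat ?ecoc ?orbT //=.
    by apply/negP => /(past_leq oN); rewrite leqNgt e'e.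
  have l1 := size_labs N (diff N (basec q) D').
  have l2 := size_labs N (diff N D C).
  have lth : ncf N (basec q) - ncf N (basec q) + size h < m.
    move: lt; rewrite /h !size_cat /=; lia.
  have [fh [rf pf wf_]] := IH q (basec q) h lth bq cB (fun _ x => x) (fun _ x _ => x) rh.
  exists fh; split=> //; first by rewrite pf /h !iproj_cat p1 p2.
  apply: le_trans wf_ _; rewrite /h !hwt_cat !hwt_diff //.
  have := cwt_sub wf oN D'D; lra.
case: rC => s' [gs rv].
(* A cut-off in [C] is an i-event, hence in the base, against [base_clean]; candidates are excluded
   by the current case. *)
have clean e : e \in map fst co ++ coc -> ~~ C e.
  move=> eco; apply/negP => Ce; have := eco; rewrite mem_cat => /orP[|ecoc]; last first.
    by apply: nococ; exists e.
  case/mapP=> -[e1 c] ec /= eE; have [_ _ ei _ _] := inv_co inv ec; rewrite -eE in ei.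
  by have := base_clean bq eco; rewrite (Cq _ Ce ei).
have [k [lk nCk cCk sE]] := fire_event cC clean gs; rewrite sE in rv.
have kN := evlab_lt lk; have Ckk : addev C k k by rewrite /addev eqxx orbT.
have qCk g : basec q g -> addev C k g by move=> /qC; rewrite /addev => ->.
have nk := ncf_addev kN nCk; have wk := cwt_addev kN nCk.
have ek : ewt N k = gweight t by rewrite /ewt lk.
have tE : (t.1 \in calph (A i)) = iev N i k.
  by rewrite (valid_calph i (occ_valid oN lk)) /iev (partbE _ lk).
have [ki|nki] := boolP (iev N i k); last first.
  have [fh [rf pf wf_]] : exists fh, [/\ run (fstep i N co) q fh,
     map (fun kt : nat * gtrans A => kt.2.1) fh = iproj i v &
     (\sum_(kt <- fh) ciw i N kt.1 <= cwt N (addev C k) - cwt N (basec q) + hwt v)%R].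
    apply: IHv => //; first by move: lt; rewrite nk /=; have := ncf_sub N qC; lia.
    move=> g /orP[Cg|/eqP->]; first exact: Cq.
    by rewrite (negbTE nki).
  exists fh; split=> //; first by rewrite pf /iproj /= tE (negbTE nki).
  apply: le_trans wf_ _; rewrite wk hwt_cons ek; lra.
(* An i-event consumes the i-condition of the cut, which is [q], so [k] is an edge leaving [q]. *)
have qk : q \in evpre N k by rewrite -(base_mk bq qC Cq); apply: (pre_mk oN cC cCk nCk).
have qi : q.2 = i by rewrite -(base_mk bq qC Cq) /mk mkn2.
have [c [bc sc ec]] := companion kN ki.
have pk g : past N k g -> addev C k g by apply: (conf_past oN cCk Ckk).
have [r1 e1] := conf_run oN (past_conf oN kN) cCk pk.
(* The events of [C] outside [[k]] do not belong to this edge; they are replayed after it, from the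
   state of [[c]]. *)
pose h := labs N (diff N (past N k) (addev C k)) ++ v.
have rh : run (@gstep _ _ _ A) (st N (past N c)) h.
  by rewrite sc; apply/run_cat; split=> //; rewrite e1.
have p1 : iproj i (labs N (diff N (past N k) (addev C k))) = [::].
  apply: iproj_diff0 => // g /orP[Cg gi|/eqP-> _]; last exact: past_refl.
  by apply: (edge_sub qk); apply: Cq.
have s1 := size_diff N pk; have l1 := size_labs N (diff N (past N k) (addev C k)).
have s2 : ncf N (basec q) < ncf N (past N k).
  apply: (@ncf_lt _ _ _ _ _ _ _ k (past_conf oN kN)) => [g||].
  - exact: edge_sub.
  - exact: past_refl.
  - exact: edge_fresh.
have lth : ncf N (past N c) - ncf N (past N c) + size h < m.
  by move: lt; rewrite /h !size_cat /=; lia.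
have [fh [rf pf wf_]] := IH (Some c, i) (past N c) h lth bc (base_conf bc)
   (fun _ x => x) (fun _ x _ => x) rh.
exists ((k, t) :: fh); split.
- exists (Some c, i); split=> //; do !split=> //.
  by exists q; do !split=> //; apply: rst_refl.
- by rewrite /= pf /h iproj_cat p1 /iproj /= tE ki.
- rewrite big_cons (ciwE qk qi) hwt_cons -ek.
  move: wf_; rewrite /= /h hwt_cat hwt_diff // wk; lra.
Qed.

End Fold.

(** * Minimal weights and equality of weighted trace sets *)

Section Traces.
Variables (Sig : finType) (R : realType) (n : nat) (A : 'I_n -> wlts Sig R) (i : 'I_n).

(** Histories with the word of [h] have its length, so they are among finitely many tuples and a
    minimal weight is attained. *)
Lemma global_wtrace_le (h : seq (gtrans A)) : run (@gstep _ _ _ A) (ginit A) h ->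
  exists2 w, global_wtrace A (map fst h) w & (w <= hwt h)%R.
Proof.
move=> rh.
pose P (x : (size h).-tuple (gtrans A)) :=
  `[< run (@gstep _ _ _ A) (ginit A) x /\ map fst x = map fst h >].
have P0 : P (in_tuple h) by apply/asboolP.
case: (@arg_minP _ _ _ (in_tuple h) P (fun x => hwt x) P0) => x /asboolP[rx ex] xmin.
exists (hwt x); last exact: (xmin _ P0).
split; first by exists x.
move=> h' rh' eh'; have sz : size h' == size h by rewrite -(size_map fst h') eh' size_map.
by apply: (xmin (Tuple sz)); apply/asboolP.
Qed.

(** Soundness makes every folded weight the weight of a history; completeness puts some folded
    weight below that of any history. Hence both minima coincide, and one is attained when the other
    is. *)
Lemma fold_wtraceP (N : net A) co coc : (forall j, wlts_wf (A j)) -> alg_inv i N co coc ->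
  alg_final (N, co, coc) -> forall sigma w,
  fold_wtrace i N co sigma w <-> wproj (global_wtrace A) (calph (A i)) sigma w.
Proof.
move=> wf inv fin sigma w; have oN := inv_occ inv.
have sound fh : run (fstep i N co) (None, i) fh -> exists h,
    [/\ run (@gstep _ _ _ A) (ginit A) h,
        iproj i h = map (fun kt : nat * gtrans A => kt.2.1) fh &
        hwt h = (\sum_(kt <- fh) ciw i N kt.1)%R].
  by move=> /(fold_sound inv); rewrite /basec /= st0.
have complete h : run (@gstep _ _ _ A) (ginit A) h -> exists fh,
    [/\ run (fstep i N co) (None, i) fh,
        map (fun kt : nat * gtrans A => kt.2.1) fh = iproj i h &
        (\sum_(kt <- fh) ciw i N kt.1 <= hwt h)%R].
  move=> rh; have b0 : baseq i N co (None, i) by left.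
  have := @fold_complete_conf _ _ _ _ _ _ _ _ inv wf fin (None, i) pred0 h b0 (conf0 N).
  rewrite st0 => /(_ (fun _ x => x) (fun _ x _ => x) rh)[fh [rf pf wf']].
  by exists fh; split=> //; move: wf'; rewrite subrr add0r.
split=> [[[fh [rf [lf wE]]] wmin]|[[s [[[h [rh [lh wE]]] _] ps]] wmin]].
- have [h [rh ph wh]] := sound _ rf.
  have low h' : run (@gstep _ _ _ A) (ginit A) h' -> iproj i h' = sigma -> (w <= hwt h')%R.
    move=> /complete[fh' [rf' pf' wf']] ph'; apply: le_trans wf'.
    by apply: wmin => //; rewrite pf'.
  split.
    exists (map fst h); split; last by rewrite -lf.
    split; first by exists h; split=> //; split=> //; rewrite -wE.
    by move=> h' rh' lh'; apply: low => //; rewrite /iproj lh' -lf.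
  by move=> s w' [[h' [rh' [lh' <-]]] _] ps; apply: low => //; rewrite /iproj lh'.
- have low h' : run (@gstep _ _ _ A) (ginit A) h' -> iproj i h' = sigma -> (w <= hwt h')%R.
    move=> rh' ph'; have [w' gw' le'] := global_wtrace_le rh'.
    exact: le_trans (wmin _ _ gw' ph') le'.
  have lowf fh : run (fstep i N co) (None, i) fh ->
      map (fun kt : nat * gtrans A => kt.2.1) fh = sigma ->
      (w <= \sum_(kt <- fh) ciw i N kt.1)%R.
    by move=> /sound[h' [rh' ph' <-]] lf; apply: low => //; rewrite ph'.
  split=> //; have [fh [rf pf wf']] := complete _ rh.
  have lf : map (fun kt : nat * gtrans A => kt.2.1) fh = sigma.
    by rewrite pf /iproj lh.
  exists fh; split=> //; split=> //; apply/eqP; rewrite eq_le lowf // andbT.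
  by apply: le_trans wf' _; rewrite -wE.
Qed.

End Traces.

(** * Infinite pigeonhole, stabilisation and descending sequences *)

Section Infinite.

Definition infinitely (P : nat -> Prop) := forall m, exists2 k, m <= k & P k.

Lemma infinitely_pigeonhole (T : finType) (P : nat -> Prop) (f : nat -> T) :
  infinitely P -> exists v, infinitely (fun k => P k /\ f k = v).
Proof.
move=> infP; apply: contrapT => nv.
have /choice[B HB] : forall v, exists m, forall k, m <= k -> P k -> f k <> v.
  move=> v; apply: contrapT => h; apply: nv; exists v => m.
  apply: contrapT => h'; apply: h; exists m => k mk Pk fk; apply: h'.
  by exists k.
have [k mk Pk] := infP (\max_v B v).
by apply: (HB (f k) k _ Pk); rewrite // (leq_trans _ mk) // leq_bigmax.
Qed.

Lemma infinitely_seq (P : nat -> Prop) : infinitely P ->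
  exists2 f : nat -> nat, (forall l, P (f l)) & forall l, f l < f l.+1.
Proof.
move=> infP; have [k0 _ Pk0] := infP 0.
have next (x : {k | P k}) : {y : {k | P k} | sval x < sval y}.
  apply: cid; have [k xk Pk] := infP (sval x).+1.
  by exists (exist _ k Pk).
have [f [_ Hf]] := dependent_choice next (exist _ k0 Pk0).
by exists (fun l => sval (f l)) => l; [exact: svalP (f l) | exact: Hf].
Qed.

Lemma stabilize (T : finType) (f : nat -> {set T}) l :
  (forall m m', l <= m -> m <= m' -> f m \subset f m') ->
  exists2 s, l <= s & forall m, s <= m -> f m = f s.
Proof.
move=> mono.
have ex : exists c, `[< exists2 m, l <= m & #|f m| = c >].
  by exists #|f l|; apply/asboolP; exists l.
have ub c : `[< exists2 m, l <= m & #|f m| = c >] -> c <= #|T|.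
  by move=> /asboolP[m _ <-]; apply: max_card.
case: (ex_maxnP ex ub) => c /asboolP[s ls <-] smax; exists s => // m sm.
apply/esym/eqP; rewrite eqEcard mono //=; apply: smax; apply/asboolP.
by exists m => //; apply: leq_trans sm.
Qed.

Lemma stabilize_anti (T : finType) (f : nat -> {set T}) :
  (forall m m', m <= m' -> f m' \subset f m) ->
  exists s, forall m, s <= m -> f m = f s.
Proof.
move=> anti; have [|s _ Hs] := @stabilize T (fun m => ~: f m) 0.
  by move=> m m' _ mm'; rewrite setCS anti.
by exists s => m /Hs /setC_inj.
Qed.

Lemma not_Acc_seq (T : Type) (r : T -> T -> Prop) x : ~ Acc r x ->
  exists2 s : nat -> T, s 0 = x & forall m, r (s m.+1) (s m).
Proof.
move=> nx.
have next (y : {y | ~ Acc r y}) : {z : {z | ~ Acc r z} | r (sval z) (sval y)}.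
  apply: cid; case: y => y ny /=; apply: contrapT => h; apply: ny; constructor=> z zy.
  by apply: contrapT => nz; apply: h; exists (exist _ z nz).
have [s [s0 Hs]] := dependent_choice next (exist _ x nx).
by exists (fun m => sval (s m)); rewrite ?s0 // => m; apply: Hs.
Qed.

End Infinite.

(** * Awareness of components and the relation [<<] *)

Section Clocks.
Variables (Sig : finType) (R : realType) (n : nat) (A : 'I_n -> wlts Sig R).
Variables (N : net A) (oN : occurrence_net N).

(* The components that know about [a] in [[e]]: those whose condition in M(e) was
   produced causally at or after [a]. *)
Definition aware a e : {set 'I_n} :=
  [set j | if (mk N (past N e) j).1 is Some g then past N g a else false].

Lemma awareP a e j : reflect
  (exists2 g, mk N (past N e) j = (Some g, j) & [/\ past N e g, partb N g j & past N g a])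
  (j \in aware a e).
Proof.
rewrite inE; case E: (mk N (past N e) j) => [o j'] /=.
have j'E : j' = j by rewrite -(mkn2 N (past N e) (size N) j) [mkn _ _ _ _]E.
case: o E => [g|] E; last by constructor=> -[].
apply: (iffP idP) => [ga|[g' [<-] _ []]] //; exists g; first by rewrite j'E.
have [] // : [/\ past N e g, partb N g j & g < size N].
by apply: (@mkn_some _ _ _ _ N (past N e) (size N) j g); rewrite [mkn _ _ _ _]E.
Qed.

Lemma last_event e g j : e < size N -> past N e g -> partb N g j ->
  exists h, [/\ mk N (past N e) j = (Some h, j), past N e h, partb N h j & past N h g].
Proof.
move=> eN eg gj.
have [h hE gh] := @mkn_max _ _ _ _ N (past N e) (size N) j g eg gj (partb_lt gj).
have [eh hj _] : [/\ past N e h, partb N h j & h < size N].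
  by apply: (@mkn_some _ _ _ _ N (past N e) (size N) j h); rewrite hE.
exists h; split=> //; exact: (part_total oN (past_conf oN eN) eg eh gj hj gh).
Qed.

Lemma aware_event a e g j : e < size N -> past N e g -> partb N g j -> past N g a ->
  j \in aware a e.
Proof.
move=> eN eg gj ga; have [h [hE eh hj hg]] := last_event eN eg gj.
by apply/awareP; exists h => //; split=> //; apply: past_trans hg ga.
Qed.

Lemma aware_mono a e e' : e' < size N -> past N e' e -> aware a e \subset aware a e'.
Proof.
move=> e'N e'e; apply/subsetP => j /awareP[g _ [eg gj ga]].
by apply: (aware_event e'N _ gj ga); apply: past_trans e'e eg.
Qed.

Lemma aware_anti a a' e : past N a' a -> aware a' e \subset aware a e.
Proof.
move=> aa'; apply/subsetP => j /awareP[g gE [eg gj ga]].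
by apply/awareP; exists g => //; split=> //; apply: past_trans ga aa'.
Qed.

Lemma mkn_eq C C' m j : (forall k, partb N k j -> C k = C' k) -> mkn N C m j = mkn N C' m j.
Proof.
by move=> h; elim: m => //= m ->; have := h m; case: (partb N m j); rewrite ?andbF // => ->.
Qed.

(* Descending from [e'], every event of [[e']] \ [[e]] feeds another one through a
   component which is aware already in [[e]], hence itself comes after [a]. *)
Lemma aware_stable a e e' j : e < size N -> e' < size N -> past N e a -> past N e' e ->
  aware a e = aware a e' -> j \notin aware a e -> mk N (past N e') j = mk N (past N e) j.
Proof.
move=> eN e'N ea e'e E nj.
have new g j' : past N e' g -> ~~ past N e g -> partb N g j' -> j' \in aware a e.
  have [m] := ubnP (e' - g); elim: m g j' => // m IH g j' lt e'g neg gj'.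
  rewrite E; suff ga : past N g a by apply: aware_event gj' ga.
  case: (past_first e'g) => [->|[j2 [g2 [gj2 gg2 e'g2]]]]; first exact: past_trans e'e ea.
  have gg2' := occ_index oN gg2; have g2e' := past_leq oN e'g2.
  have g2j2 : partb N g2 j2 := pre_part oN gg2.
  have neg2 : ~~ past N e g2.
    by apply/negP => eg2; case/negP: neg; apply: past_pre_trans eg2 gg2.
  have /awareP[h _ [eh hj2 ha]] : j2 \in aware a e.
    by apply: (IH g2) => //; move: lt; lia.
  have e'h := past_trans e'e eh; have cC := past_conf oN e'N.
  apply: past_trans _ ha; case: (leqP h g) => [|/ltnW] hg.
    exact: (part_total oN cC e'h e'g hj2 gj2 hg).
  case/negP: neg; apply: past_trans eh _.
  exact: (part_total oN cC e'g e'h gj2 hj2 hg).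
apply: mkn_eq => k kj; apply/idP/idP => [e'k|]; last exact: past_trans e'e.
apply: contrapT => nek; case/negP: nj; apply: (new k) => //; exact/negP.
Qed.

(** Conditions on which M(x) and M(w) differ belong to components of [S]. There, those of M(x) are
    consumed inside [[z]], because M(z) was produced at or after [y], and those of M(w) were
    produced at or after [z]; the required path runs through [z]. *)
Lemma llt_aware x y z w (S : {set 'I_n}) : w < size N ->
  past N y x -> x < y -> past N z y -> past N w z ->
  (forall j, j \notin S -> mk N (past N w) j = mk N (past N x) j) ->
  S \subset aware y z -> S \subset aware z w -> llt N x w.
Proof.
move=> wN yx xy zy wz out Sy Sz.
have wx : past N w x := past_trans wz (past_trans zy yx).
have xz := leq_trans xy (past_leq oN zy); have xw := leq_trans xz (past_leq oN wz).
have zN := past_size wz; have xN := past_size yx.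
split; first by apply/nlt_past => //; split=> // E; rewrite E ltnn in xw.
move=> b b' /(inM_mk oN _ wN) bw nbx /(inM_mk oN _ xN) b'x nb'w.
have bS : b.2 \in S.
  by apply: contrapT => /negP/out E; apply: nbx; apply/inM_mk => //; rewrite -E.
have b'S : b'.2 \in S.
  by apply: contrapT => /negP/out E; apply: nb'w; apply/inM_mk => //; rewrite E.
have /awareP[g gE [_ gj gz]] := subsetP Sz _ bS.
have /awareP[h hE [_ _ hy]] := subsetP Sy _ b'S.
have [k [zk b'k]] : exists k, past N z k /\ b' \in evpre N k.
  apply: contrapT => nk.
  have xb' : mark N (past N x) b' by apply/(markP oN) => //; apply: past_conf.
  have zx k : past N x k -> past N z k by move/(past_trans yx)/(past_trans zy).
  have : mark N (past N z) b'.
    case: xb' => ib' [pb' _]; split=> //; split=> //.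
    by case: (b'.1) pb' => // a /zx.
  move/(markP oN _ (past_conf oN zN)); rewrite hE => b'E.
  have [_ [+ _]] := xb'; rewrite b'E /= => /(past_leq oN).
  by have := past_leq oN hy; lia.
apply/nlt_condE; exists g, k; rewrite bw gE; split=> //.
by have /pastP[] := past_trans gz zk.
Qed.

(** The preset of an event enabled at [C] is forced by its label: it consists of the marked
    conditions of the participating components. Then [occ_ext] applies. *)
Lemma enabled_inj C g g' t : conf N C -> conf N (addev C g) -> conf N (addev C g') ->
  ~~ C g -> ~~ C g' -> evlab N g = Some t -> evlab N g' = Some t -> g = g'.
Proof.
move=> cC cg cg' ng ng' lg lg'; apply: (occ_ext oN lg lg').
have sub x y : conf N (addev C x) -> conf N (addev C y) -> ~~ C x -> ~~ C y ->
    evlab N x = Some t -> evlab N y = Some t -> {subset evpre N x <= evpre N y}.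
  move=> cx cy nx ny lx ly b bx; have xb := pre_part oN bx.
  have -> : b = mk N C b.2.
    by apply: (occ_pre_inj oN bx (pre_mk oN cC cx nx xb)); rewrite /mk mkn2.
  by apply: (pre_mk oN cC cy ny); rewrite (partbE _ ly) -(partbE _ lx).
by move=> b; apply/idP/idP; apply: sub.
Qed.

End Clocks.

(** * Impossibility of an infinite run *)

Section Termination.
Variables (Sig : finType) (R : realType) (n : nat) (A : 'I_n -> wlts Sig R) (i : 'I_n).
Variable s : nat -> astate A.
Hypothesis s0 : s 0 = ainit A.
Hypothesis sS : forall m, alg_step i (s m) (s m.+1).

Definition netat m : net A := (s m).1.1.
Definition coat m := (s m).1.2.
Definition cocat m := (s m).2.

Lemma stepat m : alg_step i (netat m, coat m, cocat m) (netat m.+1, coat m.+1, cocat m.+1).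
Proof. by have := sS m; rewrite /netat /coat /cocat; case: (s m) (s m.+1) => [[? ?] ?] [[? ?] ?]. Qed.

Lemma invat m : alg_inv i (netat m) (coat m) (cocat m).
Proof.
elim: m => [|m IH]; last exact: alg_inv_step IH (stepat m).
by rewrite /netat /coat /cocat s0; apply: alg_inv_init.
Qed.

Lemma occat m : occurrence_net (netat m). Proof. exact: inv_occ (invat m). Qed.

Lemma netatS m : exists x, netat m.+1 = netat m ++ [:: x].
Proof. exact: alg_step_cat (stepat m). Qed.

Lemma size_netat m : size (netat m) = m.
Proof.
elim: m => [|m IH]; first by rewrite /netat s0.
by have [x ->] := netatS m; rewrite size_cat IH addn1.
Qed.

Lemma netat_cat m m' : m <= m' -> exists X, netat m' = netat m ++ X.
Proof.
move=> /subnK <-; elim: (m' - m) => [|p [X IH]]; first by exists [::]; rewrite cats0.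
by rewrite addSn; have [x ->] := netatS (p + m); exists (X ++ [:: x]); rewrite IH catA.
Qed.

Lemma coat_sub m m' k : m <= m' -> k \in map fst (coat m) -> k \in map fst (coat m').
Proof.
move=> /subnK <- km; elim: (m' - m) => // p IH; rewrite addSn.
have [t [M [_ [_ [_ /=]]]]] := stepat (p + m).
case=> [[c [_ [_ [_ [_ [-> _]]]]]]|[_ [_ [-> _]]]|[_ [_ [-> _]]]] //.
by rewrite map_rcons mem_rcons inE IH orbT.
Qed.

(** Data about event [e] are read in the first net of the run that contains it; by the [_lim] lemmas
    later nets agree, so these notions describe the limit net. *)
Definition lpast e := past (netat e.+1) e.
Definition lpart e j := partb (netat e.+1) e j.
Definition lst e := st (netat e.+1) (lpast e).
Definition lmk e j := mk (netat e.+1) (lpast e) j.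

Lemma netat_lim m e : e < m -> exists X, [/\ netat m = netat e.+1 ++ X,
  occurrence_net (netat e.+1 ++ X) & e < size (netat e.+1)].
Proof.
move=> /netat_cat[X EX]; exists X; split=> //; last by rewrite size_netat.
by rewrite -EX; apply: occat.
Qed.

Lemma past_lim m e : e < m -> past (netat m) e = lpast e.
Proof. by move=> /netat_lim[X [-> oX eN]]; rewrite (past_cat (occat _) oX). Qed.

Lemma part_lim m e j : e < m -> partb (netat m) e j = lpart e j.
Proof. by move=> /netat_lim[X [-> oX eN]]; rewrite partb_cat. Qed.

Lemma st_lim m e : e < m -> st (netat m) (lpast e) = lst e.
Proof.
by move=> em; have [X [EX oX eN]] := netat_lim em; rewrite -(past_lim em) EX (st_past_cat (occat _) oX eN).
Qed.

Lemma mk_lim m e j : e < m -> mk (netat m) (lpast e) j = lmk e j.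
Proof.
by move=> em; have [X [EX oX eN]] := netat_lim em; rewrite -(past_lim em) EX (mk_past_cat (occat _) oX j eN).
Qed.

Lemma concurrent_lim m m' k e : k < m -> e < m -> m <= m' ->
  concurrent (netat m') (inr k) (inr e) <-> concurrent (netat m) (inr k) (inr e).
Proof.
move=> km em /netat_cat[X EX]; rewrite EX; apply: concurrent_cat; rewrite ?size_netat //.
  exact: occat.
by rewrite -EX; apply: occat.
Qed.

Lemma lpast_leq e k : lpast e k -> k <= e.
Proof. exact/past_leq/occat. Qed.

(** Two non-cut-off i-events never share a global state, since the later one would be a cut-off, and
    there are finitely many global states. *)
Lemma noncutoff_bounded : exists B, forall k m, B <= k -> k < m -> lpart k i ->
  k \in map fst (coat m).
Proof.
suff [B HB] : exists B, forall k, B <= k -> lpart k i -> k \in map fst (coat k.+1).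
  by exists B => k m Bk km ki; apply: (coat_sub km); apply: HB.
apply: contrapT => nB.
have inf : infinitely (fun k => lpart k i /\ k \notin map fst (coat k.+1)).
  move=> B; apply: contrapT => h; apply: nB; exists B => k Bk ki.
  by apply: contrapT => /negP nk; apply: h; exists k.
have [v infv] := infinitely_pigeonhole lst inf.
have [c _ [[ci _] cv]] := infv 0; have [k ck [[ki nk] kv]] := infv c.+1.
have kN : k < size (netat k.+1) by rewrite size_netat.
apply: (inv_noncut (invat k.+1) kN ki nk); split=> //; exists c; split=> //.
have ck1 : c < k.+1 by apply: ltnW.
split; first by rewrite /iev part_lim.
apply/(sameStE (occat _)) => //; first by rewrite size_netat.
by rewrite !past_lim // !st_lim // kv cv.
Qed.

(** The Koenig step. For [e] beyond [m0], the least event of [[e]] outside [D] is enabled at [D].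
    Some label occurs for infinitely many [e], and by [enabled_inj] the event is then always the
    same. *)
Lemma extend_infinite (D : pred nat) m0 : conf (netat m0) D ->
  infinitely (fun e => forall k, D k -> lpast e k) ->
  exists2 g, ~~ D g & (exists m, conf (netat m) (addev D g)) /\
    infinitely (fun e => forall k, addev D g k -> lpast e k).
Proof.
move=> cD infD.
have Dm k : D k -> k < m0 by case: cD => sD _ _ /sD; rewrite size_netat.
have confat m : m0 <= m -> conf (netat m) D.
  by move=> /netat_cat[X ->]; apply/conf_cat => // k /Dm; rewrite size_netat.
have ref e : lpast e e by apply: past_refl; rewrite size_netat.
have /choice[g Hg] : forall e, exists g, m0 <= e ->
    [/\ lpast e g, ~~ D g & forall x, x < g -> lpast e x -> D x].
  move=> e; case: (leqP m0 e) => [me|]; last by exists 0.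
  have ex : exists g, lpast e g && ~~ D g.
    by exists e; rewrite ref; apply/negP => /Dm; rewrite ltnNge me.
  case: (ex_minnP ex) => g /andP[eg ng] gmin; exists g => _; split=> // x xg ex'.
  by apply: contrapT => /negP nx; have := gmin x; rewrite ex' nx => /(_ isT); rewrite leqNgt xg.
have confg e m : m0 <= e -> e < m -> (forall k, D k -> lpast e k) -> conf (netat m) (addev D (g e)).
  move=> me em De; have [eg ng gmin] := Hg _ me.
  have ce : conf (netat m) (lpast e).
    by rewrite -(past_lim em); apply: past_conf; [apply: occat | rewrite size_netat].
  apply: (conf_sub ce) => [k /orP[/De//|/eqP->//]|k a j].
  have [_ dD _] := confat _ (ltnW (leq_ltn_trans me em)); have [_ dE _] := ce.
  case/orP=> [Dk ak|/eqP-> ak]; rewrite /addev; first by rewrite (dD _ _ _ Dk ak).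
  by rewrite gmin //; [exact: occ_index (occat m) _ _ _ ak | exact: dE eg ak].
have infD' : infinitely (fun e => m0 <= e /\ forall k, D k -> lpast e k).
  move=> m; have [e me De] := infD (maxn m m0); move: me; rewrite geq_max => /andP[h1 h2].
  by exists e.
have [v infv] := infinitely_pigeonhole (fun e => evlab (netat (g e).+1) (g e)) infD'.
have [e1 _ [[m1 De1] v1]] := infv 0; have [eg1 ng1 _] := Hg _ m1.
have geq e : m0 <= e -> (forall k, D k -> lpast e k) ->
    evlab (netat (g e).+1) (g e) = v -> g e = g e1.
  move=> me De ve; have [eg ng _] := Hg _ me.
  pose m := (maxn e e1).+1; have em : e < m by rewrite ltnS leq_maxl.
  have em1 : e1 < m by rewrite ltnS leq_maxr.
  have gem : g e < m := leq_ltn_trans (lpast_leq eg) em.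
  have gem1 : g e1 < m := leq_ltn_trans (lpast_leq eg1) em1.
  have lab x : x < m -> evlab (netat m) x = evlab (netat x.+1) x.
    by move=> /netat_lim[X [-> _ xN]]; rewrite evlab_cat.
  have [|t lt] := @evlabP _ _ _ _ (netat m) (g e); first by rewrite size_netat.
  apply: (enabled_inj (occat m) _ (confg _ _ me em De) (confg _ _ m1 em1 De1) ng ng1 lt).
    exact: confat (ltnW (leq_ltn_trans me em)).
  by rewrite lab // v1 -ve -lab.
exists (g e1) => //; split; first by exists e1.+1; apply: confg.
move=> m; have [e me [[m0e De] ve]] := infv m; exists e => // k.
case/orP=> [/De//|/eqP->]; rewrite -(geq e) //; by have [] := Hg _ m0e.
Qed.

(** Iteration adds events [g l] one at a time; infinitely many share a component, and these are
    causally ordered by [part_total]. *)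
Lemma infinite_chain : exists e : nat -> nat,
  forall l, lpast (e l.+1) (e l) /\ e l < e l.+1.
Proof.
pose P (D : pred nat) := (exists m, conf (netat m) D) /\
  infinitely (fun e => forall k, D k -> lpast e k).
have P0 : P pred0 by split; [exists 0; apply: conf0 | move=> m; exists m].
have next (x : {D | P D}) : {y : {D | P D} | exists g, ~~ sval x g /\ sval y = addev (sval x) g}.
  apply: cid; case: x => D [[m cD] infD] /=.
  by have [g ng Pg] := extend_infinite cD infD; exists (exist _ (addev D g) Pg); exists g.
have [DD [_ /choice[g HD]]] := dependent_choice next (exist P (pred0 : pred nat) P0).
pose D l := sval (DD l); have PD l : P (D l) := svalP (DD l).
have DS l : D l.+1 = addev (D l) (g l).
  by have := HD l => -[].
have Dg l : ~~ D l (g l) by have := HD l => -[].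
have Dgl l : D l.+1 (g l) by rewrite DS /addev eqxx orbT.
have Dmono l l' k : l <= l' -> D l k -> D l' k.
  by move=> /subnK <- Dk; elim: (l' - l) => // p IH; rewrite addSn DS /addev IH.
have /choice[f Hf] : forall l, exists j, lpart (g l) j.
  by move=> l; apply: (event_part (occat _)); rewrite size_netat.
have infT : infinitely (fun _ => True) by move=> m; exists m.
have [j infj] := infinitely_pigeonhole f infT.
have [p Hp pS] := infinitely_seq infj.
exists (fun l => g (p l)) => l; set x := g (p l); set y := g (p l.+1).
have xj : lpart x j by have [_ <-] := Hp l; apply: Hf.
have yj : lpart y j by have [_ <-] := Hp l.+1; apply: Hf.
have Dx : D (p l.+1) x by apply: (Dmono (p l).+1).
have [[m1 c1] _] := PD (p l.+1); have [[m2 c2] _] := PD (p l.+1).+1.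
have D2x : D (p l.+1).+1 x by apply: Dmono Dx.
have D2y : D (p l.+1).+1 y by apply: Dgl.
have ltx : x < m2 by case: c2 => + _ _; move=> /(_ _ D2x); rewrite size_netat.
have lty : y < m2 by case: c2 => + _ _; move=> /(_ _ D2y); rewrite size_netat.
have ltx1 : x < m1 by case: c1 => + _ _; move=> /(_ _ Dx); rewrite size_netat.
have xj2 : partb (netat m2) x j by rewrite part_lim.
have yj2 : partb (netat m2) y j by rewrite part_lim.
(* Otherwise [y] would lie in [[x]], hence already in [D (p l.+1)], to which it is newly added. *)
have lt : x < y.
  rewrite ltnNge; apply/negP => yx.
  have := part_total (occat m2) c2 D2y D2x yj2 xj2 yx; rewrite past_lim // -(past_lim ltx1).
  by move=> /(conf_past (occat m1) c1 Dx); apply/negP/Dg.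
split=> //.
by have := part_total (occat m2) c2 D2x D2y xj2 yj2 (ltnW lt); rewrite past_lim.
Qed.

Lemma no_infinite_run : False.
Proof.
have [e eS] := infinite_chain; have [B HB] := noncutoff_bounded.
have ref k : lpast k k by apply: past_refl; rewrite size_netat.
have etrans k k' k'' : lpast k k' -> lpast k' k'' -> lpast k k''.
  move=> kk' k'k''; have k'k := lpast_leq kk'; have k'S : k' < k.+1 by [].
  by apply: (past_trans kk'); rewrite past_lim.
have epast l m : l <= m -> lpast (e m) (e l).
  move=> /subnK <-; elim: (m - l) => [|p IH]; first exact: ref.
  by rewrite addSn; apply: etrans (eS _).1 IH.
have eleq l m : l <= m -> e l <= e m by move=> /epast/lpast_leq.
have elt l m : l < m -> e l < e m by move=> lm; apply: leq_trans (eS l).2 (eleq _ _ lm).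
have egrow l : l <= e l by elim: l => // l IH; apply: leq_ltn_trans IH (eS l).2.
pose G l m : {set 'I_n} := aware (netat (e m).+1) (e l) (e m).
have Glim l m M : e m < M -> aware (netat M) (e l) (e m) = G l m.
  move=> mM; apply/setP => j; rewrite !inE !past_lim // !mk_lim //.
  case E: (lmk (e m) j).1 => [g|] //.
  have [/lpast_leq gm _ _] : [/\ lpast (e m) g, partb (netat (e m).+1) g j & g < size (netat (e m).+1)].
    exact: (@mkn_some _ _ _ _ (netat (e m).+1) (lpast (e m)) (size _) j g E).
  by rewrite !past_lim // (leq_ltn_trans gm mM).
have pastN l m M : l <= m -> e m < M -> past (netat M) (e m) (e l).
  by move=> lm mM; rewrite past_lim //; apply: epast.
have szN l M : e l < M -> e l < size (netat M) by rewrite size_netat.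
have Gmono l m m' : l <= m -> m <= m' -> G l m \subset G l m'.
  move=> lm mm'; have em' := ltnSn (e m').
  rewrite -(Glim l m (e m').+1) -?(Glim l m' (e m').+1) ?ltnS ?eleq //.
  by apply: (aware_mono (occat _)); [apply: szN | apply: pastN].
have Ganti l l' m : l <= l' -> l' <= m -> G l' m \subset G l m.
  by move=> ll' l'm; apply: aware_anti; apply: pastN => //; rewrite ltnS eleq.
(* From [u l] on, the set of components aware of [e l] is constant. *)
have /choice[u Hu] : forall l, exists u, l <= u /\ forall m, u <= m -> G l m = G l u.
  by move=> l; have [u lu Hu] := stabilize (Gmono l); exists u.
(* These limit sets decrease with [l], so from [l0] on they all equal [G l0 (u l0)]. *)
have [l0 Hl0] : exists l0, forall l, l0 <= l -> G l (u l) = G l0 (u l0).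
  apply: stabilize_anti => l l' ll'; have [lu Hl] := Hu l; have [lu' Hl'] := Hu l'.
  rewrite -(Hl _ (leq_maxl (u l) (u l'))) -(Hl' _ (leq_maxr (u l) (u l'))).
  by apply: Ganti => //; rewrite (leq_trans lu') ?leq_maxr.
(* [llt_aware] is applied to [e l], [e l.+1], [e (u l.+1)] and [e m]: the nested thresholds make the
   limit set aware of the second event at the third, and of the third at the fourth. Outside it,
   [aware_stable] freezes the conditions from [u l0] on. *)
have lltE l m M : u l0 <= l -> u (u l.+1) <= m -> e m < M -> llt (netat M) (e l) (e m).
  move=> Ll Lm mM; have [l0u Hul0] := Hu l0; have [lu1 Hu1] := Hu l.+1.
  have [uu1 Huu] := Hu (u l.+1).
  have l0l := leq_trans l0u Ll; have zm := leq_trans uu1 Lm; have lm := ltnW (leq_trans lu1 zm).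
  have zM : e (u l.+1) < M := leq_ltn_trans (eleq _ _ zm) mM.
  have yM : e l.+1 < M := leq_ltn_trans (eleq _ _ lu1) zM.
  have xM : e l < M := leq_ltn_trans (eleq _ _ lm) mM.
  apply: (@llt_aware _ _ _ _ (netat M) (occat M) (e l) (e l.+1) (e (u l.+1)) (e m) (G l0 (u l0))).
  - exact: szN.
  - exact: pastN.
  - exact: elt.
  - exact: pastN.
  - exact: pastN.
  - move=> j nj; apply: (@aware_stable _ _ _ _ (netat M) (occat M) (e l0)).
    + exact: szN.
    + exact: szN.
    + exact: pastN.
    + exact: pastN.
    + by rewrite !Glim // !Hul0 // (leq_trans Ll lm).
    + by rewrite Glim // Hul0.
  - by rewrite Glim // Hl0 // ltnW.
  - by rewrite Glim // Huu // Hl0 // (leq_trans l0l) // ltnW.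
(* An i-event of index at least [B] becomes a cut-off, and nothing lies above a cut-off, whereas the
   chain continues above [e l]. *)
have inotco l g : lpast (e l) g -> lpart g i -> g < B.
  move=> lg gi; rewrite ltnNge; apply/negP => Bg.
  have gl := lpast_leq lg; have gS : g < e l.+1 := leq_ltn_trans gl (eS l).2.
  have gco : g \in map fst (coat (e l.+1).+1) by apply: HB => //; apply: ltnW.
  have eg : e l.+1 = g.
    apply: (inv_past (invat (e l.+1).+1)); first by rewrite mem_cat gco.
      by rewrite past_lim //; apply: etrans (eS l).1 lg.
    by rewrite size_netat.
  by rewrite eg ltnn in gS.
(* Concurrency is recorded only with events below [B], where all members of [Con] lie by
   [noncutoff_bounded], and it is read in the first net containing both events. *)
pose cset (l : nat) : {set 'I_B} := [set k : 'I_B | `[< concurrent (netat (maxn k (e l)).+1) (inr (val k)) (inr (e l)) >]].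
(* By [inotco] the producer of ip(e l) has index below [B], so [inord] loses nothing. *)
pose ipv (l : nat) : option 'I_B.+1 := omap inord (lmk (e l) i).1.
have infL : infinitely (fun l => u l0 <= l /\ B <= e l).
  move=> m; exists (maxn m (maxn (u l0) B)); first exact: leq_maxl.
  split; first by rewrite (leq_trans _ (leq_maxr _ _)) ?leq_maxl.
  by rewrite (leq_trans _ (egrow _)) // (leq_trans _ (leq_maxr _ _)) ?leq_maxr.
(* Two chain elements agreeing in St, ip and recorded concurrency, the second beyond the threshold
   of [lltE], will be a witness and its candidate. *)
have [v infv] := infinitely_pigeonhole (fun l => (lst (e l), ipv l, cset l)) infL.
have [l _ [[Ll Bl] vl]] := infv 0.
have [m lm [[_ Bm] vm]] := infv (maxn l.+1 (u (u l.+1))).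
move: lm; rewrite geq_max => /andP[lm um].
move: vl; rewrite -vm => -[stE ipE cE].
have lmkE l' : lmk (e l') i = (if (lmk (e l') i).1 is Some g then Some g else None, i) /\
    (if (lmk (e l') i).1 is Some g then g < B else true).
  have := mkn2 (netat (e l').+1) (lpast (e l')) (size (netat (e l').+1)) i.
  rewrite -/(mk _ _ _) -/(lmk _ _); case E: (lmk (e l') i) => [[g|] j] /= -> //; split=> //.
  have [lg gi gs] : [/\ lpast (e l') g, partb (netat (e l').+1) g i & g < size (netat (e l').+1)].
    by apply: (@mkn_some _ _ _ _ (netat (e l').+1) (lpast (e l')) (size _) i g); rewrite [mkn _ _ _ _]E.
  by apply: inotco lg _; rewrite size_netat in gs; rewrite part_lim in gi.
have ipEq : lmk (e l) i = lmk (e m) i.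
  have [-> hl] := lmkE l; have [-> hm] := lmkE m; move: ipE hl hm; rewrite /ipv.
  case: (lmk (e l) i).1 => [g|]; case: (lmk (e m) i).1 => [g'|] //= [].
  move/(congr1 val) => /= + hl hm; rewrite !inordK ?ltnS 1?ltnW // => -> //.
have nei : ~~ lpart (e m) i.
  by apply/negP => /(inotco m _ (ref _)); rewrite ltnNge Bm.
have candM M : e m < M -> cand (netat M) i (coat M) (e m).
  move=> mM; have lM := ltn_trans (elt _ _ lm) mM.
  split; first by rewrite /iev part_lim.
  exists (e l); split; first exact: lltE.
  split; first by apply/(sameStE (occat M)); rewrite ?size_netat // !past_lim // !st_lim // stE.
  split; first by apply/(sameipE i (occat M)); rewrite ?size_netat // !past_lim // !mk_lim.
  move=> k [kM [ki [kco kc]]]; split=> //; split=> //; split=> //.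
  rewrite size_netat in kM.
  have kB : k < B.
    rewrite ltnNge; apply/negP => Bk; case/negP: kco; apply: HB => //.
    by rewrite -(part_lim _ kM).
  have hm : k < (maxn k (e m)).+1 /\ e m < (maxn k (e m)).+1 by rewrite !ltnS leq_maxl leq_maxr.
  have hl : k < (maxn k (e l)).+1 /\ e l < (maxn k (e l)).+1 by rewrite !ltnS leq_maxl leq_maxr.
  apply/(concurrent_lim hl.1 hl.2); first by rewrite gtn_max kM.
  move/(concurrent_lim hm.1 hm.2): kc; rewrite gtn_max kM => /(_ mM) kc.
  have : Ordinal kB \in cset m by rewrite inE; apply/asboolP.
  by rewrite -cE inE => /asboolP.
(* Being a candidate at every stage, [e m] enters [coc] when it is added, and no later step frees
   it. *)
have cocM M : e m < M -> e m \in cocat M.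
  elim: M => // M IH; rewrite ltnS leq_eqVlt => mM.
  have cd := candM M.+1; rewrite ltnS in cd.
  have [t [X [_ [_ [EN /=]]]]] := stepat M; rewrite size_netat => step.
  case/orP: mM => [/eqP mE|mM].
    have {}cd := cd (eq_leq mE); rewrite mE in cd.
    case: step => [[c [_ [ei _]]]|[_ [_ [_ ->]]]|[_ [nc [Eco _]]]].
    - by move: nei; rewrite /lpart mE => /negP.
    - by rewrite mE mem_rcons mem_head.
    - by case: nc; rewrite -Eco.
  have mem := IH mM.
  case: step => [[c [_ [_ [_ [_ [_ ->]]]]]]|[_ [_ [_ ->]]]|[_ [_ [Eco ->]]]] //.
    by rewrite mem_rcons inE mem orbT.
  by rewrite mem_filter mem andbT; apply/asboolP; rewrite -Eco; apply: cd; apply: ltnW.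
have em1 := elt m m.+1 (ltnSn m).
(* The step that adds [e m.+1], which has [e m] in its past, violates [past_free]. *)
have [t [X [_ [pf [EN _]]]]] := stepat (e m.+1).
apply: (pf (e m)); first by rewrite mem_cat cocM ?orbT.
rewrite -EN size_netat; apply/(nlt_past (occat _)); rewrite past_lim //.
by split; [exact: (eS m).1 | move=> E; rewrite E ltnn in em1].
Qed.

End Termination.

Theorem theorem4 (Sig : finType) (R : realType) (n : nat)
    (A : 'I_n -> wlts Sig R) (i : 'I_n)
    (wf : forall j, wlts_wf (A j)) :
  Acc (fun s' s => alg_step i s s') (ainit A) /\
  forall N co coc,
    clos_refl_trans (astate A) (alg_step i) (ainit A) (N, co, coc) ->
    alg_final (N, co, coc) ->
    forall sigma w,
      fold_wtrace i N co sigma w <-> wproj (global_wtrace A) (calph (A i)) sigma w.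
Proof.
split; last by move=> N co coc /alg_inv_reach inv; apply: fold_wtraceP.
apply: contrapT => nacc; have [s s0 sS] := not_Acc_seq nacc.
exact: (no_infinite_run s0 sS).
Qed.
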